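(* Let $\Gamma$ be a locally compact metrizable amenable group, and let $P:\Gamma\to\mathbb{R}/\mathbb{Z}$ be a polynomial map. Then either $P$ is totally well-distributed with respect to Haar measure on $\mathbb{R}/\mathbb{Z}$, or $P$ takes values in a coset of a finite subgroup of $\mathbb{R}/\mathbb{Z}$.
   Context: Polynomial maps: for a function $f:\Gamma\to G$ into an abelian group $G$ (written additively) and $\gamma\in\Gamma$, let $\Delta_\gamma f(x)=f(\gamma x)-f(x)$. A continuous $P:\Gamma\to G$ is a polynomial map of degree at most $d$ ($d\ge 0$) if $\Delta_{\gamma_{d+1}}\cdots\Delta_{\gamma_1}P=0$ for all $\gamma_1,\dots,\gamma_{d+1}\in\Gamma$; it is a polynomial map if this holds for some $d$. Let $m_\Gamma$ be a left Haar measure on $\Gamma$. A F\o lner sequence is a sequence $(F_n)_{n\ge 1}$ of measurable subsets of $\Gamma$ with $0<m_\Gamma(F_n)<\infty$ such that $m_\Gamma(\gamma F_n\triangle F_n)/m_\Gamma(F_n)\to 0$ for every $\gamma\in\Gamma$. A function $f\in L^\infty(\Gamma)$ has mean $z_0\in\mathbb{C}$ if $\lim_{n}\frac{1}{m_\Gamma(F_n)}\int_{F_n} f\,dm_\Gamma=z_0$ for every F\o lner sequence $(F_n)$ in $\Gamma$. A Borel map $\phi:\Gamma\to X$ into a compact metrizable space $X$ is well-distributed with respect to a Borel probability measure $\mu$ on $X$ if for every continuous $f:X\to\mathbb{C}$ the function $f\circ\phi$ has mean $\int f\,d\mu$. $\Gamma$ acts on functions by $(\gamma\phi)(x)=\phi(\gamma^{-1}x)$.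 The map $\phi:\Gamma\to X$ is totally well-distributed with respect to $\mu$ if for every closed finite-index subgroup $\Gamma_0<\Gamma$ and every $\gamma\in\Gamma$, the restriction of $\gamma\phi$ to $\Gamma_0$ is well-distributed with respect to $\mu$, as a map from the locally compact amenable group $\Gamma_0$ to $X$. *)

(* Defs.v *)
From HB Require Import structures.
From mathcomp Require Import all_boot all_order all_algebra.
From mathcomp Require Import all_classical all_reals all_analysis.
From mathcomp Require Import complex.
Import Order.TTheory GRing.Theory Num.Theory.
Import numFieldTopology.Exports numFieldNormedType.Exports.

Set Implicit Arguments.
Unset Strict Implicit.
Unset Printing Implicit Defensive.

Local Open Scope classical_set_scope.
Local Open Scope complex_scope.
Local Open Scope ring_scope.

HB.mixin Record isTopologicalGroup G & Topological G & Group G := {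
  mulg_continuous : continuous (fun x : G * G => (x.1 * x.2)%g);
  invg_continuous : continuous (fun x : G => (x^-1)%g)
}.

(* [Pointed] is only there because the library's measurable types are pointed;
   the chosen point plays no role. *)
#[short(type="topologicalGroupType")]
HB.structure Definition TopologicalGroup :=
  {G of Topological G & Pointed G & Group G & isTopologicalGroup G}.

(* A subgroup with its subspace topology, as a topological group. *)
Section subgroup_type.
Context {G : topologicalGroupType}.
Implicit Type H : groupClosed G.

Definition subgroup_type H : Type := {x : G | x \in H}.

HB.instance Definition _ H := SubType.on (subgroup_type H).
HB.instance Definition _ H := [Choice of subgroup_type H by <:].

Lemma subgroup_group_closed H : group_closed H.
Proof. by split=> [|x y xH yH]; [exact: gpred1|exact: gpredF]. Qed.

HB.instance Definition _ H := SubChoice_isSubGroup.Build G _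
  (subgroup_type H) (subgroup_group_closed H).

HB.instance Definition _ H :=
  isPointed.Build (subgroup_type H) (1%g : subgroup_type H).

HB.instance Definition _ H := Topological.copy (subgroup_type H)
  (initial_topology (val : subgroup_type H -> G)).

Lemma subgroup_val_continuous H : continuous (val : subgroup_type H -> G).
Proof. exact: initial_continuous. Qed.

Lemma subgroup_continuous H (T : topologicalType) (f : T -> subgroup_type H) :
  continuous (val \o f) -> continuous f.
Proof.
move=> /continuousP cf; apply/continuousP => _ [B oB <-].
by rewrite -comp_preimage; exact: cf.
Qed.

Lemma subgroup_mulg_continuous H :
  continuous (fun x : subgroup_type H * subgroup_type H => (x.1 * x.2)%g).
Proof.
apply: subgroup_continuous => x.
have -> : val \o (fun x : subgroup_type H * subgroup_type H => (x.1 * x.2)%g) =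
  (fun y : G * G => (y.1 * y.2)%g) \o
  (fun x : subgroup_type H * subgroup_type H => (val x.1, val x.2)).
  by apply/funext.
apply: continuous_comp; last exact: mulg_continuous.
by apply: cvg_pair; apply: continuous_comp => //=;
  [exact: cvg_fst|exact: subgroup_val_continuous|exact: cvg_snd|
   exact: subgroup_val_continuous].
Qed.

Lemma subgroup_invg_continuous H :
  continuous (fun x : subgroup_type H => (x^-1)%g).
Proof.
apply: subgroup_continuous => x.
have -> : val \o (fun x : subgroup_type H => (x^-1)%g) =
  (fun y : G => (y^-1)%g) \o val by apply/funext.
apply: continuous_comp; first exact: subgroup_val_continuous.
exact: invg_continuous.
Qed.

HB.instance Definition _ H := isTopologicalGroup.Build (subgroup_type H)
  (@subgroup_mulg_continuous H) (@subgroup_invg_continuous H).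

End subgroup_type.

Definition finite_index (G : topologicalGroupType) (H : groupClosed G) : Prop :=
  finite_set [set [set (g * h)%g | h in [set` H]] | g in [set: G]].

Definition metrizable (R : realType) (T : topologicalType) : Prop :=
  exists d : T -> T -> R,
    [/\ forall x y, d x y = 0 <-> x = y,
        forall x y, d x y = d y x,
        forall x y z, d x z <= d x y + d y z
      & forall (x : T) (A : set T), nbhs x A <->
          exists2 e : R, 0 < e & [set y | d x y < e] `<=` A].

(* [T] with its Borel sigma-algebra. *)
Notation borel T := (g_sigma_algebraType (@open T)).

Section haar.
Context (R : realType) (G : topologicalGroupType).
Local Open Scope ereal_scope.
Implicit Type m : {measure set (borel G) -> \bar R}.

(* A nonzero left-invariant Radon measure; when [G] is not sigma-compact, Radon
   means outer regular on Borel sets and inner regular on open sets. *)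
Definition left_haar m : Prop :=
  [/\ forall (g : G) (A : set G), measurable (A : set (borel G)) ->
        m [set (g * x)%g | x in A] = m A,
      forall K : set G, compact K -> m K < +oo,
      forall U : set G, open U -> U !=set0 -> 0 < m U,
      forall A : set G, measurable (A : set (borel G)) ->
        m A = ereal_inf [set m U | U in [set U : set G | open U /\ A `<=` U]]
    & forall U : set G, open U ->
        m U = ereal_sup [set m K | K in [set K : set G | compact K /\ K `<=` U]]].

Definition folner m (F : (set G)^nat) : Prop :=
  [/\ forall n, measurable (F n : set (borel G)),
      forall n, 0 < m (F n) < +oo
    & forall g : G,
        (fine (m ([set (g * x)%g | x in F n] `+` F n)) / fine (m (F n)))%R
          @[n --> \oo] --> (0 : R)%R].

End haar.

Definition translate (G : topologicalGroupType) (X : Type) (g : G)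
  (f : G -> X) : G -> X := fun x => f (g^-1 * x)%g.

(* Existence of a left-invariant mean on L^oo(G), i.e. of a left-invariant
   normalized linear functional that is nonnegative on the (classes of)
   functions that are nonnegative almost everywhere. *)
Definition amenable (R : realType) (G : topologicalGroupType) : Prop :=
  exists2 m : {measure set (borel G) -> \bar R}, left_haar m &
  exists M : (borel G -> R) -> R,
    [/\ forall (a : R) f g, f \in Lfun m +oo%E -> g \in Lfun m +oo%E ->
          M (fun x => a * f x + g x) = a * M f + M g,
        forall f, f \in Lfun m +oo%E ->
          {ae m, forall x, 0 <= f x} -> 0 <= M f,
        M (cst 1) = 1
      & forall (g : G) f, f \in Lfun m +oo%E -> M (translate g f) = M f].

(* Complex numbers with their usual topology: [R[i]] itself carries none, its
   regular module [R[i]^o] does. *)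
Notation Cplx R := (R[i]^o).

Definition cintegral d (T : measurableType d) (R : realType)
    (mu : {measure set T -> \bar R}) (D : set T) (f : T -> Cplx R) : Cplx R :=
  (Rintegral mu D (fun x => complex.Re (f x))) +i* (Rintegral mu D (fun x => complex.Im (f x))).

Definition cLoo d (T : measurableType d) (R : realType)
    (mu : {measure set T -> \bar R}) (f : T -> Cplx R) : Prop :=
  (fun x => complex.Re (f x)) \in Lfun mu +oo%E /\
  (fun x => complex.Im (f x)) \in Lfun mu +oo%E.

(* The left Haar measure is unique up to a positive factor, which does not
   affect this notion: it is stated for every choice of that measure. *)
Definition has_mean (R : realType) (G : topologicalGroupType)
    (f : G -> Cplx R) (z : Cplx R) : Prop :=
  forall m : {measure set (borel G) -> \bar R}, left_haar m ->
    cLoo m f /\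
    forall F : (set G)^nat, folner m F ->
      ((fine (m (F n)))^-1%:C * cintegral m (F n) f : Cplx R) @[n --> \oo] --> z.

Definition well_distributed (R : realType) (G : topologicalGroupType)
    (X : ptopologicalType) (phi : G -> X) (mu : probability (borel X) R) :
    Prop :=
  measurable_fun [set: borel G] (phi : borel G -> borel X) /\
  forall f : X -> Cplx R, continuous f ->
    has_mean (f \o phi) (cintegral mu setT f).

Definition totally_well_distributed (R : realType) (G : topologicalGroupType)
    (X : ptopologicalType) (phi : G -> X) (mu : probability (borel X) R) :
    Prop :=
  forall (H : groupClosed G), closed [set` H] -> finite_index H ->
  forall g : G,
    well_distributed (fun x : subgroup_type H => translate g phi (val x)) mu.

Section polynomial_maps.
Context (G : topologicalGroupType) (V : PreTopologicalZmodule.type).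

Definition Delta (g : G) (f : G -> V) : G -> V := fun x => f (g * x)%g - f x.

(* [foldl] applies the differences in the order g_1, ..., g_{d+1}. *)
Definition polynomial_of_degree_le (d : nat) (P : G -> V) : Prop :=
  continuous P /\
  forall (s : d.+1.-tuple G) (x : G), foldl (fun f g => Delta g f) P s x = 0.

Definition polynomial_map (P : G -> V) : Prop :=
  exists d : nat, polynomial_of_degree_le d P.

End polynomial_maps.

(* The circle R/Z with its quotient topology. *)
Section circle.
Context (R : realType).
Local Open Scope quotient_scope.

(* [Num.int_num_subdef] is the predicate underlying [Num.int]; the library's
   {ideal_quot _} only requires an additive subgroup. *)
Definition circle :=
  {ideal_quot [the zmodClosed R of @Num.int_num_subdef R : {pred R}]}.

HB.instance Definition _ := GRing.Zmodule.on circle.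
HB.instance Definition _ := EqQuotient.on circle.

Definition circle_open (U : set circle) : Prop :=
  open ((\pi_circle : R -> circle) @^-1` U).

Fact circle_openT : circle_open setT.
Proof. by rewrite /circle_open preimage_setT; exact: openT. Qed.

Fact circle_openI : setI_closed circle_open.
Proof. by move=> A B; exact: openI. Qed.

Fact circle_open_bigcup (I : Type) (F : I -> set circle) :
  (forall i, circle_open (F i)) -> circle_open (\bigcup_i F i).
Proof. by move=> oF; apply: bigcup_open => i _; exact: oF. Qed.

HB.instance Definition _ :=
  isOpenTopological.Build circle circle_openT circle_openI circle_open_bigcup.

HB.instance Definition _ := isPointed.Build circle (0 : circle).

(* The Haar probability measure on the circle is the unique [mu] such that: *)
Definition circle_haar (mu : probability (borel circle) R) : Prop :=
  forall (a : circle) (A : set circle), measurable (A : set (borel circle)) ->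
    mu [set a + x | x in A] = mu A.

End circle.

Definition in_finite_subgroup_coset (V : zmodType) (T : Type) (P : T -> V) :
    Prop :=
  exists2 K : zmodClosed V, finite_set [set` K] &
  exists a : V, forall x, P x - a \in K.

(* Main.v *)
From HB Require Import structures.
Require Import Defs.
From mathcomp Require Import all_boot all_order all_algebra.
From mathcomp Require Import all_classical all_reals all_analysis.
From mathcomp Require Import measurable_realfun complex ring lra.
Import Order.TTheory GRing.Theory Num.Theory.
Import numFieldTopology.Exports numFieldNormedType.Exports.

Set Implicit Arguments.
Unset Strict Implicit.
Unset Printing Implicit Defensive.

Local Open Scope classical_set_scope.
Local Open Scope ring_scope.

(* By Weyl's criterion it suffices that the averages of exp (2 i pi k Q) tend to
   0 for every k > 0, where Q is P on a coset of the finite-index subgroup. This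
   rests on a uniform dichotomy, by induction on the degree: for every e > 0
   there is C = C(d, e) such that for Q of degree at most d either the averages
   of exp (2 i pi Q) are eventually of squared modulus at most e, or C Q is
   constant. Indeed, van der Corput's inequality along the powers of a single
   element g shows that if the averages are not small, then the lower-degree
   dichotomy gives a constant n Delta_(g^l) Q for some 0 < l < N, hence a
   constant n Delta_(g^k) Q with k = N! independent of g. By Newton's formula
   Q (h x) = Q x + t for h = g^(k n d!) and a constant t. If t <> 0 this
   invariance forces the averages to 0; if t = 0 for every g, a multiple of Q is
   invariant under all k-th powers, and such a polynomial map becomes constant
   after multiplication by k^d. Finally, if C P is constant on a coset of a
   finite-index subgroup, then a further multiple of P is constant on the whole
   group, so P takes values in a coset of a torsion subgroup. *)

(** * Polynomial maps *)

Section polynomial_algebra.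
Context (G : topologicalGroupType) (V : PreTopologicalZmodule.type).
Implicit Types (P Q : G -> V) (g x : G).

(* Off by one: [poly_lt d.+1 P] says that [P] has degree at most [d]. *)
Fixpoint poly_lt (d : nat) P : Prop :=
  if d is d'.+1 then forall g, poly_lt d' (Delta g P) else forall x, P x = 0.

Definition constant_map P : Prop := forall x y, P x = P y.

Lemma polynomial_of_degree_le_poly_lt d P :
  polynomial_of_degree_le d P -> poly_lt d.+1 P.
Proof.
case=> _ vanish.
(* Plain sequences let the induction peel off the head, which [foldl] applies first. *)
have {vanish} : forall s : seq G, size s = d.+1 ->
    forall x, foldl (fun f g => Delta g f) P s x = 0.
  by move=> s /eqP sz x; exact: vanish (Tuple sz) x.
elim: d.+1 P => [|k IH] P vanish; first exact: (vanish [::]).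
by move=> g; apply: IH => s sz; apply: (vanish (g :: s)); rewrite /= sz.
Qed.

Lemma Delta_mulrn g P n :
  Delta g (fun x => P x *+ n) = (fun x => Delta g P x *+ n).
Proof. by apply/funext => x; rewrite /Delta mulrnBl. Qed.

Lemma poly_lt_mulrn d P n : poly_lt d P -> poly_lt d (fun x => P x *+ n).
Proof.
elim: d P => [|d IH] P /= pP; first by move=> x; rewrite pP mul0rn.
by move=> g; rewrite Delta_mulrn; exact: IH.
Qed.

(** Left translation by [a] intertwines [Delta g] with the difference along the conjugate
    [a * g * a^-1], and the hypothesis covers all group elements. *)
Lemma poly_lt_lshift d P a : poly_lt d P -> poly_lt d (fun x => P (a * x)%g).
Proof.
elim: d P => [|d IH] P /= pP; first by move=> x; rewrite pP.
move=> g; have -> : Delta g (fun x => P (a * x)%g) =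
    (fun x => Delta (a * g * a^-1)%g P (a * x)%g).
  by apply/funext => x; rewrite /Delta !mulgA mulgVK.
exact: IH.
Qed.

Lemma poly_lt1_constant P : poly_lt 1 P -> constant_map P.
Proof.
move=> pP x y; have /eqP := pP (x * y^-1)%g y.
by rewrite /Delta subr_eq0 mulgVK => /eqP.
Qed.

Lemma Delta_constant g P : constant_map P -> forall x, Delta g P x = 0.
Proof. by move=> cP x; rewrite /Delta (cP _ x) subrr. Qed.

Lemma iter_Delta_constant g P i : constant_map P ->
  forall x, iter i.+1 (Delta g) P x = 0.
Proof.
move=> cP; elim: i => [|i IH] x; first exact: Delta_constant.
by rewrite iterS /Delta !IH subrr.
Qed.

Lemma iter_Delta_mulrn g P n i :
  iter i (Delta g) (fun x => P x *+ n) = (fun x => iter i (Delta g) P x *+ n).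
Proof. by elim: i => //= i ->; rewrite Delta_mulrn. Qed.

Lemma iter_Delta_poly_lt g d P i : poly_lt d P -> (d <= i)%N ->
  forall x, iter i (Delta g) P x = 0.
Proof.
elim: d P i => [|d IH] P i pP.
  by move=> _; elim: i => [//|i IHi] x; rewrite iterS /Delta !IHi subrr.
by case: i => // i le x; rewrite iterSr; exact: IH.
Qed.

(** Pascal's rule: one more factor [g] adds the same expansion for [Delta g P], in which every
    difference has its order raised by one. *)
Lemma newton_forward g P j x :
  P (g ^+ j * x)%g = \sum_(i < j.+1) iter i (Delta g) P x *+ 'C(j, i).
Proof.
elim: j P => [|j IH] P.
  by rewrite big_ord_recl big_ord0 addr0 bin0 mulr1n /= expg0 mul1g.
have -> : P (g ^+ j.+1 * x)%g = P (g ^+ j * x)%g + Delta g P (g ^+ j * x)%g.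
  by rewrite /Delta addrC subrK mulgA -expgS.
rewrite !IH big_ord_recl [RHS]big_ord_recl !bin0 /= -!addrA; congr (_ + _).
rewrite [X in _ = X]big_ord_recr [X in _ + X]big_ord_recr /= !binn !mulr1n.
rewrite addrA -iterSr; congr (_ + _).
rewrite -big_split; apply: eq_bigr => i _ /=.
by rewrite -iterSr /bump leq0n add1n binS mulrnDr.
Qed.

(** With N = n d!, the identity [i * 'C(N, i) = N * 'C(N.-1, i.-1)] applies; since [i] divides d!,
    it cancels and leaves the factor [n]. *)
Lemma dvdn_bin_mul_fact n d i : (0 < i <= d)%N -> (n %| 'C(n * d`!, i))%N.
Proof.
case: i => // i /= le_id.
have [->|n0] := posnP n; first by rewrite mul0n bin0n.
have /dvdnP[q qE] : (i.+1 %| d`!)%N by apply: dvdn_fact.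
have := mul_bin_diag (n * d`!) i; rewrite {1}qE mulnA mulnAC mulnC => /eqP.
by rewrite eqn_pmul2l // => /eqP <-; rewrite -mulnA dvdn_mulr.
Qed.

(* In Newton's formula at [n * d`!] the binomials of index [1, ..., d] are
   divisible by [n], and [n] kills the differences of order at least two. *)
Lemma constant_Delta_affine d P g n : (0 < n)%N -> poly_lt d.+1 P ->
  constant_map (fun x => Delta g P x *+ n) ->
  forall x, P (g ^+ (n * d`!) * x)%g = P x + Delta g P x *+ n *+ d`!.
Proof.
move=> n0 pP cP x; rewrite newton_forward.
have : (0 < n * d`!)%N by rewrite muln_gt0 n0 fact_gt0.
case E: (n * d`!)%N => [//|m] _.
rewrite !big_ord_recl big1 ?addr0 => [|i _].
  by rewrite bin0 mulr1n /= bin1 -E mulrnA.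
rewrite !lift0; have [le_id|lt_di] := leqP i.+2 d.
  have /dvdnP[q ->] : (n %| 'C(m.+1, i.+2))%N by rewrite -E dvdn_bin_mul_fact.
  rewrite mulnC mulrnA.
  rewrite -[X in X *+ _](congr1 (@^~ x) (iter_Delta_mulrn g P n i.+2)) iterSr Delta_mulrn.
  by rewrite iter_Delta_constant ?mul0rn.
by rewrite (iter_Delta_poly_lt _ pP) ?mul0rn.
Qed.

(** The cocycle identity splits [Delta (g ^+ m.+1) P x] into [Delta g P (g ^+ m * x)] and
    [Delta (g ^+ m) P x]; after multiplication by [n] the first summand does not depend on the
    point. *)
Lemma expg_Delta_constant P g n m :
  constant_map (fun x => Delta g P x *+ n) ->
  forall x, Delta (g ^+ m)%g P x *+ n = Delta g P x *+ n *+ m.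
Proof.
move=> cP x; elim: m => [|m IH].
  by rewrite /Delta expg0 mul1g subrr mul0rn mulr0n.
rewrite mulrS -IH (cP x (g ^+ m * x)%g) -mulrnDl; congr (_ *+ _).
by rewrite /Delta expgS -mulgA addrA subrK.
Qed.

(** By induction on the degree [Delta g P] becomes constant after multiplication by a power of [k].
    Then [k] times this constant is the same multiple of [Delta (g ^+ k) P], which vanishes by
    invariance. *)
Lemma power_invariant_constant d P k : poly_lt d.+1 P ->
  (forall g x, P (g ^+ k * x)%g = P x) ->
  constant_map (fun x => P x *+ k ^ d).
Proof.
elim: d P => [|d IH] P pP inv.
  by move=> x y; rewrite (poly_lt1_constant pP x y).
have cD g : constant_map (fun x => Delta g P x *+ k ^ d).
  apply: IH => [|h x]; first exact: pP.
  (* [g * h ^+ k] equals [(g * h * g^-1) ^+ k * g], again a [k]-th power times [g]. *)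
  rewrite /Delta inv; congr (_ - _); rewrite -[RHS](inv (h ^ g^-1)%g).
  by rewrite -conjXg /conjg invgK !mulgA mulgVK.
have D0 g x : Delta g P x *+ k ^ d.+1 = 0.
  by rewrite expnSr mulrnA -expg_Delta_constant // /Delta inv subrr mul0rn.
move=> x y; apply/eqP; rewrite -subr_eq0 -mulrnBl.
by have := D0 (x * y^-1)%g y; rewrite /Delta mulgVK => ->.
Qed.

(* For [h] in the subgroup [A], induction on the degree kills a multiple of
   [Delta h P], so that a multiple of [P] is [A]-invariant. *)
Lemma constant_on_subgroup (A : set G) k d : (forall x, A (x ^+ k)%g) -> A 1%g ->
  (forall x y, A x -> A y -> A (x * y)%g) -> (0 < k)%N ->
  exists2 K, (0 < K)%N & forall P, poly_lt d.+1 P ->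
    (forall h, A h -> P h = P 1%g) -> constant_map (fun x => P x *+ K).
Proof.
move=> Ak A1 AM k0; elim: d => [|d [K K0 IH]].
  exists 1%N => // P pP _ x y; by rewrite (poly_lt1_constant pP x y).
exists (K * k ^ d.+1)%N; first by rewrite muln_gt0 K0 expn_gt0 k0.
move=> P pP cP.
have inv h x : A h -> P (h * x)%g *+ K = P x *+ K.
  move=> Ah; apply/eqP; rewrite -subr_eq0 -mulrnBl; apply/eqP.
  (* [Delta h P] vanishes on all of [A], so the constant provided by the induction is 0, its value
     at the identity. *)
  have -> := IH (Delta h P) (pP h) _ x 1%g.
    by rewrite /Delta mulg1 (cP h) // subrr mul0rn.
  by move=> h' Ah'; rewrite /Delta mulg1 !cP ?subrr //; exact: AM.
have := @power_invariant_constant d.+1 (fun x => P x *+ K) k.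
move=> /(_ (poly_lt_mulrn _ pP)) cPK x y; rewrite !mulrnA; apply: cPK => g z.
exact: inv.
Qed.

End polynomial_algebra.

(** * The circle *)

Section circle_functions.
Context (R : realType).
Local Notation T := (circle R).
Implicit Types (x y z : T) (r s : R).

Definition circle_pi (r : R) : T := (\pi_T r)%qT.

Lemma circle_piP x : exists r, x = circle_pi r.
Proof. by exists (repr x); rewrite /circle_pi reprK. Qed.

Lemma circle_piD r s : circle_pi (r + s) = circle_pi r + circle_pi s.
Proof. exact: (raddfD (\pi_T)%qT). Qed.

Lemma circle_piN r : circle_pi (- r) = - circle_pi r.
Proof. exact: (raddfN (\pi_T)%qT). Qed.

Lemma circle_piMn r n : circle_pi (r *+ n) = circle_pi r *+ n.
Proof. exact: (raddfMn (\pi_T)%qT). Qed.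

Lemma circle_pi0 : circle_pi 0 = 0.
Proof. exact: (raddf0 (\pi_T)%qT). Qed.

Lemma circle_pi_eqP r s :
  reflect (circle_pi r = circle_pi s) (r - s \is a Num.int).
Proof.
have -> : (r - s \is a Num.int) = (circle_pi r == circle_pi s).
  exact: (@Quotient.idealrBE _
    [the zmodClosed R of @Num.int_num_subdef R : {pred R}]).
exact: eqP.
Qed.

(** Real and imaginary parts of the character exp(2 i pi x), computed on the chosen representative;
    by [cosc_pi] and [sinc_pi] any other representative gives the same values. *)
Definition cosc (x : T) : R := cos (pi *+ 2 * repr x).
Definition sinc (x : T) : R := sin (pi *+ 2 * repr x).

Lemma repr_circle_pi r : exists z : int, repr (circle_pi r) = r + z%:~R.
Proof.
have /circle_pi_eqP/intrP[z zE] : circle_pi (repr (circle_pi r)) = circle_pi r.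
  by rewrite /circle_pi reprK.
by exists z; rewrite -zE addrC subrK.
Qed.

Lemma periodic_int (f : R -> R) (a : R) : periodic f a ->
  forall t (z : int), f (t + a * z%:~R) = f t.
Proof.
move=> fa t [n|n]; first by rewrite mulr_natr (periodicn fa).
by rewrite NegzE mulrNz mulrN mulr_natr -[LHS](periodicn fa n.+1) subrK.
Qed.

Lemma cosc_pi r : cosc (circle_pi r) = cos (pi *+ 2 * r).
Proof.
rewrite /cosc; have [z ->] := repr_circle_pi r.
by rewrite mulrDr periodic_int //; exact: cosD2pi.
Qed.

Lemma sinc_pi r : sinc (circle_pi r) = sin (pi *+ 2 * r).
Proof.
rewrite /sinc; have [z ->] := repr_circle_pi r.
by rewrite mulrDr periodic_int //; exact: sinD2pi.
Qed.

Lemma coscD x y : cosc (x + y) = cosc x * cosc y - sinc x * sinc y.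
Proof.
have [[r ->] [s ->]] := (circle_piP x, circle_piP y).
by rewrite -circle_piD !cosc_pi !sinc_pi mulrDr cosD.
Qed.

Lemma sincD x y : sinc (x + y) = sinc x * cosc y + cosc x * sinc y.
Proof.
have [[r ->] [s ->]] := (circle_piP x, circle_piP y).
by rewrite -circle_piD !cosc_pi !sinc_pi mulrDr sinD.
Qed.

Lemma coscN x : cosc (- x) = cosc x.
Proof. by have [r ->] := circle_piP x; rewrite -circle_piN !cosc_pi mulrN cosN. Qed.

Lemma sincN x : sinc (- x) = - sinc x.
Proof. by have [r ->] := circle_piP x; rewrite -circle_piN !sinc_pi mulrN sinN. Qed.

Lemma coscB x y : cosc (x - y) = cosc x * cosc y + sinc x * sinc y.
Proof. by rewrite coscD coscN sincN mulrN opprK. Qed.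

Lemma cosc0 : cosc 0 = 1.
Proof. by rewrite -circle_pi0 cosc_pi mulr0 cos0. Qed.

Lemma sinc0 : sinc 0 = 0.
Proof. by rewrite -circle_pi0 sinc_pi mulr0 sin0. Qed.

Lemma cosc2Dsinc2 x : cosc x ^+ 2 + sinc x ^+ 2 = 1.
Proof. exact: cos2Dsin2. Qed.

Lemma norm_cosc_le1 x : `|cosc x| <= 1. Proof. exact: cos_max. Qed.

Lemma norm_sinc_le1 x : `|sinc x| <= 1. Proof. exact: sin_max. Qed.

(** For a representative [s] in [0, 1), either the angle 2 pi s or its reflection 2 pi (1 - s) lies
    in [0, pi], where the cosine is injective. The reflected angle cannot be 0, as s < 1. *)
Lemma cosc_eq1 x : cosc x = 1 -> x = 0.
Proof.
have [r ->] := circle_piP x.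
have -> : circle_pi r = circle_pi (r - (Num.floor r)%:~R).
  by apply/circle_pi_eqP; rewrite opprB addrC subrK intr_int.
set s := r - _.
have /andP[s0 s1] : 0 <= s < 1.
  by rewrite /s subr_ge0 floor_le ltrBlDl -intrD1 floorD1_gt.
rewrite cosc_pi => c1.
have pi0 := @pi_gt0 R.
have [s2|s2] := leP s (2^-1).
  have ps0 : 0 <= pi * s by rewrite mulr_ge0 // ltW.
  have ps1 : pi * s <= pi * 2^-1 by rewrite ler_pM2l.
  have : pi *+ 2 * s = 0.
    by apply: (@cos_inj R); rewrite ?cos0 // in_itv /=; apply/andP; split; lra.
  move/eqP; rewrite mulf_eq0 mulrn_eq0 /= gt_eqF //= => /eqP ->.
  by rewrite circle_pi0.
have ps0 : pi * s <= pi by rewrite -[leRHS]mulr1 ler_pM2l // ltW.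
have ps1 : pi * 2^-1 <= pi * s by rewrite ler_pM2l // ltW.
have : pi *+ 2 * (1 - s) = 0.
  apply: (@cos_inj R); rewrite ?cos0 // ?in_itv /=.
  - by apply/andP; split; lra.
  - by apply/andP; split; lra.
  - by rewrite mulrBr mulr1 -cosN opprB -[LHS]cosD2pi subrK.
move/eqP; rewrite mulf_eq0 mulrn_eq0 /= gt_eqF //= subr_eq0 => /eqP s1E.
by rewrite -s1E ltxx in s1.
Qed.

Lemma continuous_circle_pi : continuous circle_pi.
Proof. by apply/continuousP => A. Qed.

Lemma continuous_circle (U : topologicalType) (f : T -> U) :
  continuous (f \o circle_pi) -> continuous f.
Proof. by move=> /continuousP fc; apply/continuousP => A oA; exact: fc. Qed.

Lemma continuous_cosc : continuous cosc.
Proof.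
apply: continuous_circle.
have -> : cosc \o circle_pi = cos \o (fun r => pi *+ 2 * r).
  by apply/funext => r /=; rewrite cosc_pi.
move=> r; apply: continuous_comp; last exact: continuous_cos.
exact: mulrl_continuous.
Qed.

Lemma continuous_sinc : continuous sinc.
Proof.
apply: continuous_circle.
have -> : sinc \o circle_pi = sin \o (fun r => pi *+ 2 * r).
  by apply/funext => r /=; rewrite sinc_pi.
move=> r; apply: continuous_comp; last exact: continuous_sin.
exact: mulrl_continuous.
Qed.

Lemma circle_compact : compact [set: T].
Proof.
have -> : [set: T] = circle_pi @` `[0, 1]%classic.
  apply/seteqP; split => // x _; have [r ->] := circle_piP x.
  exists (r - (Num.floor r)%:~R).
    by rewrite /= in_itv /= subr_ge0 floor_le lerBlDl -intrD1 ltW // floorD1_gt.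
  by apply/circle_pi_eqP; rewrite addrC addKr rpredN intr_int.
apply: continuous_compact; last exact: segment_compact.
exact/continuous_subspaceT/continuous_circle_pi.
Qed.

Lemma circle_torsion_finite n : (0 < n)%N -> finite_set [set x : T | x *+ n = 0].
Proof.
move=> n0; apply: (@sub_finite_set _ _
  ((fun i : nat => circle_pi (i%:R / n%:R)) @` `I_n)); last first.
  exact/finite_image/finite_II.
move=> x /=; have [r ->] := circle_piP x; rewrite -circle_piMn -circle_pi0.
move=> /circle_pi_eqP; rewrite subr0 => /intrP[z zE].
have n0' : n%:R != 0 :> R by rewrite pnatr_eq0 -lt0n.
have nz : (n : int) != 0 by rewrite -lt0n.
(* Here r = z / n, and reducing z modulo n changes this quotient by an integer. *)
exists `|(z %% n)%Z|%N => /=.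
  by rewrite -ltz_nat gez0_abs ?modz_ge0 // ltz_pmod.
apply/circle_pi_eqP.
rewrite natr_absz ger0_norm ?modz_ge0 //.
have -> : r = z%:~R / n%:R by rewrite -zE -[r *+ n]mulr_natr mulfK.
rewrite -mulrBl -intrB {2}(divz_eq z n) opprD addrC subrK -mulNr.
by rewrite intrM mulfK // intr_int.
Qed.

End circle_functions.

(** * Van der Corput *)

Section bounded_continuous.
Context (R : realType) (T : topologicalType).
Implicit Types (f g : T -> R).

Lemma continuous_realD f g : continuous f -> continuous g ->
  continuous (fun x => f x + g x).
Proof. by move=> cf cg x; apply: cvgD; [exact: cf|exact: cg]. Qed.

Lemma continuous_realM f g : continuous f -> continuous g ->
  continuous (fun x => f x * g x).
Proof. by move=> cf cg x; apply: cvgM; [exact: cf|exact: cg]. Qed.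

(** Boundedness makes these functions integrable over every Borel set of finite measure. *)
Definition bounded_continuous f : Prop :=
  continuous f /\ exists B, forall x, `|f x| <= B.

Lemma bounded_continuous_cst c : bounded_continuous (fun=> c).
Proof. by split; [exact: cst_continuous|exists `|c|]. Qed.

Lemma bounded_continuousD f g : bounded_continuous f -> bounded_continuous g ->
  bounded_continuous (fun x => f x + g x).
Proof.
move=> [cf [B fB]] [cg [C gC]]; split.
  exact: continuous_realD.
by exists (B + C) => x; rewrite (le_trans (ler_normD _ _)) // lerD.
Qed.

Lemma bounded_continuousM f g : bounded_continuous f -> bounded_continuous g ->
  bounded_continuous (fun x => f x * g x).
Proof.
move=> [cf [B fB]] [cg [C gC]]; split.
  exact: continuous_realM.
by exists (B * C) => x; rewrite normrM ler_pM.
Qed.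

Lemma bounded_continuous_sum (I : Type) (r : seq I) (F : I -> T -> R) :
  (forall i, bounded_continuous (F i)) ->
  bounded_continuous (fun x => \sum_(i <- r) F i x).
Proof.
move=> bF; elim: r => [|i r IH].
  by under eq_fun do rewrite big_nil; exact: bounded_continuous_cst.
by under eq_fun do rewrite big_cons; exact: bounded_continuousD.
Qed.

End bounded_continuous.

Lemma cvg_sum0 (R : realType) (I : Type) (r : seq I) (F : I -> nat -> R) :
  (forall i, F i n @[n --> \oo] --> 0) ->
  \sum_(i <- r) F i n @[n --> \oo] --> 0.
Proof.
move=> F0; elim: r => [|i r IH].
  by rewrite (_ : (fun n => _) = (fun=> 0));
    [exact: cvg_cst|apply/funext => n; rewrite big_nil].
rewrite (_ : (fun n => _) = (fun n => F i n + \sum_(j <- r) F j n)); last first.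
  by apply/funext => n; rewrite big_cons.
by rewrite -[X in _ --> X]addr0; exact: cvgD.
Qed.

Section circle_continuous.
Context (R : realType) (T : topologicalType).
Implicit Types P Q : T -> circle R.

(* Sums of such maps are again such maps by the addition formulas, which avoids
   the continuity of the addition of the circle. *)
Definition circle_continuous P : Prop :=
  continuous (fun x => cosc (P x)) /\ continuous (fun x => sinc (P x)).

Lemma continuous_circle_continuous P : continuous P -> circle_continuous P.
Proof.
move=> cP; split=> x.
  by apply: (@continuous_comp _ _ _ P (@cosc R)); [exact: cP|exact: continuous_cosc].
by apply: (@continuous_comp _ _ _ P (@sinc R)); [exact: cP|exact: continuous_sinc].
Qed.

Lemma circle_continuousD P Q : circle_continuous P -> circle_continuous Q ->
  circle_continuous (fun x => P x + Q x).
Proof.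
move=> [cP sP] [cQ sQ]; split=> x.
  under eq_fun do rewrite coscD.
  by apply: cvgB; apply: cvgM; [exact: cP|exact: cQ|exact: sP|exact: sQ].
under eq_fun do rewrite sincD.
by apply: cvgD; apply: cvgM; [exact: sP|exact: cQ|exact: cP|exact: sQ].
Qed.

Lemma circle_continuousN P : circle_continuous P ->
  circle_continuous (fun x => - P x).
Proof.
move=> [cP sP]; split=> x; first by under eq_fun do rewrite coscN; exact: cP.
by under eq_fun do rewrite sincN; apply: cvgN; exact: sP.
Qed.

Lemma circle_continuousMn P k : circle_continuous P ->
  circle_continuous (fun x => P x *+ k).
Proof.
move=> cP; elim: k => [|k IH].
  by split=> x; under eq_fun do rewrite mulr0n; exact: cvg_cst.
by under eq_fun do rewrite mulrS; exact: circle_continuousD.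
Qed.

Lemma bounded_continuous_cosc P : circle_continuous P ->
  bounded_continuous (fun x => cosc (P x)).
Proof. by case=> cP _; split=> //; exists 1 => x; exact: norm_cosc_le1. Qed.

Lemma bounded_continuous_sinc P : circle_continuous P ->
  bounded_continuous (fun x => sinc (P x)).
Proof. by case=> _ cP; split=> //; exists 1 => x; exact: norm_sinc_le1. Qed.

End circle_continuous.

(** * Abstract averages on a group and van der Corput's inequality *)

Section averaging.
Context (R : realType) (G : topologicalGroupType).
Implicit Types (f h : G -> R) (g : G) (Q : G -> circle R).

Lemma lmul_continuous g : continuous (fun x : G => (g * x)%g).
Proof.
move=> x; have := @mulg_continuous G (g, x) => /= gc.
apply: (@continuous_comp _ _ _ (fun x => (g, x)) (fun y => y.1 * y.2)%g x) => //.
by apply: cvg_pair => //; exact: cvg_cst.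
Qed.

Lemma bounded_continuous_lmul g f : bounded_continuous f ->
  bounded_continuous (fun x => f (g * x)%g).
Proof.
move=> [cf [B fB]]; split; last by exists B.
move=> x; apply: (@continuous_comp _ _ _ (fun x => (g * x)%g) f).
  exact: lmul_continuous.
exact: cf.
Qed.

Lemma circle_continuous_lmul g Q : circle_continuous Q ->
  circle_continuous (fun x => Q (g * x)%g).
Proof.
move=> cQ; split.
  exact: (bounded_continuous_lmul g (bounded_continuous_cosc cQ)).1.
exact: (bounded_continuous_lmul g (bounded_continuous_sinc cQ)).1.
Qed.

Lemma circle_continuous_Delta g Q : circle_continuous Q ->
  circle_continuous (Delta g Q).
Proof.
move=> cQ; apply: circle_continuousD; first exact: circle_continuous_lmul.
exact: circle_continuousN.
Qed.

(** The properties of averages along a Følner sequence on which the van der Corput and Weyl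
    arguments rest: linearity, monotonicity, normalization and asymptotic left invariance.
    [averaging_folner] supplies them. *)
Definition averaging (A : nat -> (G -> R) -> R) : Prop :=
  [/\ forall n a f h, bounded_continuous f -> bounded_continuous h ->
        A n (fun x => a * f x + h x) = a * A n f + A n h,
      forall n f h, bounded_continuous f -> bounded_continuous h ->
        (forall x, f x <= h x) -> A n f <= A n h,
      forall n, A n (fun=> 1) = 1
    & forall g f, bounded_continuous f ->
        A n (fun x => f (g * x)%g) - A n f @[n --> \oo] --> 0].

Context (A : nat -> (G -> R) -> R) (avA : averaging A).

Let avL n a f h : bounded_continuous f -> bounded_continuous h ->
  A n (fun x => a * f x + h x) = a * A n f + A n h.
Proof. by case: avA => L _ _ _; exact: L. Qed.

Let avle n f h : bounded_continuous f -> bounded_continuous h ->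
  (forall x, f x <= h x) -> A n f <= A n h.
Proof. by case: avA => _ M _ _; exact: M. Qed.

Let avshift g f : bounded_continuous f ->
  A n (fun x => f (g * x)%g) - A n f @[n --> \oo] --> 0.
Proof. by case: avA => _ _ _ S; exact: S. Qed.

Lemma average_cst n c : A n (fun=> c) = c.
Proof.
have b0 := @bounded_continuous_cst R G 0.
have A0 : A n (fun=> 0) = 0.
  have := avL n 1 b0 b0; under eq_fun do rewrite mul1r addr0.
  by rewrite mul1r -{1}[A n _]addr0 => /addrI.
have := avL n c (@bounded_continuous_cst R G 1) b0.
under eq_fun do rewrite mulr1 addr0.
by move=> ->; rewrite A0 addr0; case: avA => _ _ -> _; rewrite mulr1.
Qed.

Lemma averageD n f h : bounded_continuous f -> bounded_continuous h ->
  A n (fun x => f x + h x) = A n f + A n h.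
Proof.
by move=> bf bh; rewrite -[A n f]mul1r -avL //; congr (A n _);
  apply/funext => x; rewrite mul1r.
Qed.

Lemma averageZ n a f : bounded_continuous f ->
  A n (fun x => a * f x) = a * A n f.
Proof.
move=> bf; have := avL n a bf (@bounded_continuous_cst R G 0).
by under eq_fun do rewrite addr0; rewrite average_cst addr0.
Qed.

Lemma average_sum n (I : Type) (r : seq I) (F : I -> G -> R) :
  (forall i, bounded_continuous (F i)) ->
  A n (fun x => \sum_(i <- r) F i x) = \sum_(i <- r) A n (F i).
Proof.
move=> bF; elim: r => [|i r IH].
  by under eq_fun do rewrite big_nil; rewrite average_cst big_nil.
under eq_fun do rewrite big_cons.
by rewrite averageD ?IH ?big_cons //; exact: bounded_continuous_sum.
Qed.

Lemma average_bound n f B : bounded_continuous f -> (forall x, `|f x| <= B) ->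
  `|A n f| <= B.
Proof.
move=> bf fB; rewrite ler_norml; apply/andP; split.
  rewrite -[leLHS](average_cst n); apply: avle => // [|x].
    exact: bounded_continuous_cst.
  by have := fB x; rewrite ler_norml => /andP[].
rewrite -[leRHS](average_cst n); apply: avle => // [|x].
  exact: bounded_continuous_cst.
by have := fB x; rewrite ler_norml => /andP[].
Qed.

(** The variance is nonnegative: expand the average of [(f x - a) ^+ 2], where [a] is the average of
    [f]. *)
Lemma sqr_average_le n f : bounded_continuous f ->
  A n f ^+ 2 <= A n (fun x => f x ^+ 2).
Proof.
move=> bf; have bf2 : bounded_continuous (fun x => f x ^+ 2).
  exact: bounded_continuousM.
set a := A n f.
have : 0 <= A n (fun x => (f x ^+ 2) + ((- 2 * a) * f x + a ^+ 2)).
  rewrite -(average_cst n 0); apply: avle => [||x].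
  - exact: bounded_continuous_cst.
  - apply: bounded_continuousD => //; apply: bounded_continuousD.
      by apply: bounded_continuousM => //; exact: bounded_continuous_cst.
    exact: bounded_continuous_cst.
  - rewrite [leRHS](_ : _ = (f x - a) ^+ 2) ?sqr_ge0 //; ring.
have baf : bounded_continuous (fun x => - 2 * a * f x).
  by apply: bounded_continuousM => //; exact: bounded_continuous_cst.
have ba2 := @bounded_continuous_cst R G (a ^+ 2).
rewrite (averageD n bf2 (bounded_continuousD baf ba2)) (averageD n baf ba2).
rewrite averageZ // average_cst -/a => h.
rewrite -subr_ge0; apply: le_trans h _; rewrite le_eqVlt.
by apply/orP; left; apply/eqP; ring.
Qed.

(* The squared modulus of the average of [exp (2 i pi Q)]. *)
Definition phase_mean n Q : R :=
  A n (fun x => cosc (Q x)) ^+ 2 + A n (fun x => sinc (Q x)) ^+ 2.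

Lemma average_cosc_le n Q d : 0 <= d -> phase_mean n Q <= d ^+ 2 ->
  A n (fun x => cosc (Q x)) <= d.
Proof.
move=> d0 le_d; rewrite -(ger0_norm d0) (le_trans (ler_norm _)) //.
rewrite -ler_sqr ?nnegrE // !real_normK ?num_real //.
by apply: le_trans le_d; rewrite lerDl sqr_ge0.
Qed.

(** Let z be the average of exp(2 i pi Q). Translation by [g] multiplies z by exp(2 i pi t) but
    changes it only by o(1), so (exp(2 i pi t) - 1) z tends to 0, and the factor is not 0. *)
Lemma phase_mean_rotation g Q t : circle_continuous Q -> t != 0 ->
  (forall x, Q (g * x)%g = Q x + t) -> phase_mean n Q @[n --> \oo] --> 0.
Proof.
move=> cQ t0 Qt.
have bc := bounded_continuous_cosc cQ; have bs := bounded_continuous_sinc cQ.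
have ct : 2 - 2 * cosc t != 0.
  apply: contra_neq t0 => ct; apply: cosc_eq1; lra.
have Zc := fun n a => averageZ n a bc; have Zs := fun n a => averageZ n a bs.
have bZ a f : bounded_continuous f -> bounded_continuous (fun x => a * f x).
  by move=> bf; apply: bounded_continuousM => //; exact: bounded_continuous_cst.
have p0 := avshift g bc; have q0 := avshift g bs.
(* [2 - 2 * cosc t] is the squared modulus of exp(2 i pi t) - 1, so this expression is exact. *)
have -> : (fun n => phase_mean n Q) = (fun n => (2 - 2 * cosc t)^-1 *
    ((A n (fun x => cosc (Q (g * x)%g)) - A n (fun x => cosc (Q x))) ^+ 2 +
     (A n (fun x => sinc (Q (g * x)%g)) - A n (fun x => sinc (Q x))) ^+ 2)).
  apply/funext => n.
  have -> : (fun x => cosc (Q (g * x)%g)) =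
      (fun x => cosc t * cosc (Q x) + (- sinc t) * sinc (Q x)).
    by apply/funext => x; rewrite Qt coscD; ring.
  have -> : (fun x => sinc (Q (g * x)%g)) =
      (fun x => sinc t * cosc (Q x) + cosc t * sinc (Q x)).
    by apply/funext => x; rewrite Qt sincD; ring.
  rewrite !averageD ?Zc ?Zs; try exact: bZ.
  rewrite /phase_mean; set a := A n _; set b := A n _.
  have := cosc2Dsinc2 t; move: ct; move: (cosc t) (sinc t) => c s ct cs1.
  apply: (mulfI ct); rewrite mulrA divff // mul1r.
  have -> : 2 - 2 * c = 1 - 2 * c + (c ^+ 2 + s ^+ 2) by rewrite cs1; ring.
  ring.
rewrite -[X in _ --> X](_ : (2 - 2 * cosc t)^-1 * (0 ^+ 2 + 0 ^+ 2) = 0); last first.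
  by rewrite expr0n addr0 mulr0.
apply: cvgM; first exact: cvg_cst.
by apply: cvgD; apply: cvgM.
Qed.

(** Up to o(1), the average of exp(2 i pi Q) is that of the mean of its translates by the first [N]
    powers of [g]. Cauchy-Schwarz and expansion of the square leave [N] diagonal terms, contributing
    [N%:R^-1], and correlations of size at most [d] up to o(1). *)
Lemma van_der_corput Q g N d e : circle_continuous Q -> (0 < N)%N -> 0 <= d ->
  N%:R^-1 + d < e ->
  (forall l, (0 < l < N)%N ->
     \forall n \near \oo, phase_mean n (Delta (g ^+ l)%g Q) <= d ^+ 2) ->
  \forall n \near \oo, phase_mean n Q <= e.
Proof.
move=> cQ N0 d0 lt_e corr.
(* The errors add up to [7 * eta]: one [eta] from the correlations and three from each of the two
   squares. The bound by 1 serves to linearize those squares. *)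
pose eta := Num.min 1 ((e - (N%:R^-1 + d)) / 8).
have eta0 : 0 < eta by rewrite lt_min ltr01 divr_gt0 // subr_gt0.
have eta1 : eta <= 1 by rewrite ge_min lexx.
have eta_e : N%:R^-1 + d + 7 * eta <= e.
  have : eta <= (e - (N%:R^-1 + d)) / 8 by rewrite ge_min lexx orbT.
  by move: eta0; rewrite ler_pdivlMr // => *; lra.
have cQi i := circle_continuous_lmul (g ^+ i)%g cQ.
have bci i := bounded_continuous_cosc (cQi i).
have bsi i := bounded_continuous_sinc (cQi i).
have bc := bounded_continuous_cosc cQ; have bs := bounded_continuous_sinc cQ.
have cQij i j : circle_continuous (fun x => Q (g ^+ i * x)%g - Q (g ^+ j * x)%g).
  by apply: circle_continuousD => //; exact: circle_continuousN.
pose corr_le n i j :=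
  A n (fun x => cosc (Q (g ^+ i * x)%g - Q (g ^+ j * x)%g)) <= d + eta.
(* The phase difference is [Delta (g ^+ (i - j)) Q] translated by [g ^+ j]; undoing the translation
   costs at most [eta]. *)
have corr_lt i j : (j < i < N)%N -> \forall n \near \oo, corr_le n i j.
  move=> /andP[ji iN].
  have l0 : (0 < i - j < N)%N by rewrite subn_gt0 ji (leq_ltn_trans (leq_subr _ _)).
  have bD := bounded_continuous_cosc (circle_continuous_Delta (g ^+ (i - j))%g cQ).
  have /cvgr0_norm_le /(_ _ eta0) sh := avshift (g ^+ j)%g bD.
  near=> n; rewrite /corr_le.
  have -> : (fun x => cosc (Q (g ^+ i * x)%g - Q (g ^+ j * x)%g)) =
      (fun x => cosc (Delta (g ^+ (i - j))%g Q (g ^+ j * x)%g)).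
    by apply/funext => x; rewrite /Delta mulgA -expgnDr subnK // ltnW.
  have h1 : A n (fun x => cosc (Delta (g ^+ (i - j))%g Q x)) <= d.
    by apply: average_cosc_le => //; near: n; exact: corr.
  rewrite -lerBlDl; apply: le_trans (lerB (lexx _) h1) _.
  by apply: le_trans (ler_norm _) _; near: n.
have corr_ne (i j : 'I_N) : i != j -> \forall n \near \oo, corr_le n i j.
  rewrite -val_eqE neq_ltn => /orP[ij|ji]; last first.
    by apply: corr_lt; rewrite ji ltn_ord.
  have := @corr_lt j i; rewrite ij ltn_ord => /(_ isT).
  apply: filterS => n; rewrite /corr_le; congr (_ <= _); congr (A n _).
  by apply/funext => x; rewrite -opprB coscN.
(* There are finitely many pairs, so one threshold for [n] serves them all. *)
have corr_all : \forall n \near \oo, forall p : 'I_N * 'I_N,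
    p.1 != p.2 -> corr_le n p.1 p.2.
  apply: filter_forall => -[i j] /=.
  have [->|ij] := eqVneq i j; first by apply: nearW => n; rewrite ?eqxx.
  by have := corr_ne _ _ ij; apply: filterS.
have N1 : N%:R != 0 :> R by rewrite pnatr_eq0 -lt0n.
have mean_shift (F : G -> R) : bounded_continuous F ->
    N%:R^-1 * (\sum_(i < N) A n (fun x => F (g ^+ i * x)%g)) - A n F
      @[n --> \oo] --> 0.
  move=> bF.
  have -> : (fun n => N%:R^-1 * (\sum_(i < N) A n (fun x => F (g ^+ i * x)%g)) -
      A n F) = (fun n => N%:R^-1 * \sum_(i < N) (A n (fun x => F (g ^+ i * x)%g) - A n F)).
    apply/funext => n; rewrite sumrB sumr_const card_ord mulrBr; congr (_ - _).
    by rewrite -[A n F *+ N]mulr_natl mulrA mulVf // mul1r.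
  rewrite -[X in _ --> X](mulr0 (N%:R^-1)); apply: cvgM; first exact: cvg_cst.
  by apply: cvg_sum0 => i; exact: avshift.
have /cvgr0_norm_le /(_ _ eta0) hu := mean_shift _ bc.
have /cvgr0_norm_le /(_ _ eta0) hv := mean_shift _ bs.
near=> n.
have u_le : `|N%:R^-1 * (\sum_(i < N) A n (fun x => cosc (Q (g ^+ i * x)%g)))
   - A n (fun x => cosc (Q x))| <= eta by near: n.
have v_le : `|N%:R^-1 * (\sum_(i < N) A n (fun x => sinc (Q (g ^+ i * x)%g)))
   - A n (fun x => sinc (Q x))| <= eta by near: n.
have c_le := average_bound n bc (fun x => norm_cosc_le1 (Q x)).
have s_le := average_bound n bs (fun x => norm_sinc_le1 (Q x)).
have sq_le : (\sum_(i < N) A n (fun x => cosc (Q (g ^+ i * x)%g))) ^+ 2 +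
    (\sum_(i < N) A n (fun x => sinc (Q (g ^+ i * x)%g))) ^+ 2 <=
    N%:R + N%:R ^+ 2 * (d + eta).
  rewrite -!average_sum //.
  have bC := bounded_continuous_sum (index_enum 'I_N) (fun i : 'I_N => bci i).
  have bS := bounded_continuous_sum (index_enum 'I_N) (fun i : 'I_N => bsi i).
  apply: le_trans (lerD (sqr_average_le n bC) (sqr_average_le n bS)) _.
  rewrite -averageD; [|exact: bounded_continuousM|exact: bounded_continuousM].
  have -> : (fun x => (\sum_(i < N) cosc (Q (g ^+ i * x)%g)) ^+ 2 +
      (\sum_(i < N) sinc (Q (g ^+ i * x)%g)) ^+ 2) = (fun x =>
     \sum_(i < N) \sum_(j < N) cosc (Q (g ^+ i * x)%g - Q (g ^+ j * x)%g)).
    apply/funext => x; rewrite !expr2 !mulr_suml -big_split.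
    apply: eq_bigr => i _ /=.
    rewrite !mulr_sumr -big_split; apply: eq_bigr => j _ /=.
    by rewrite coscB.
  rewrite average_sum; last first.
    by move=> i; apply: bounded_continuous_sum => j; exact: bounded_continuous_cosc.
  (* The bound is distributed over the rows: 1 for the diagonal entry and [d + eta] for each of the
     [N] columns, the diagonal one included. *)
  have -> : N%:R + N%:R ^+ 2 * (d + eta) = \sum_(i < N) (1 + \sum_(j < N) (d + eta)).
    rewrite big_split /= !sumr_const !card_ord -mulrnA.
    by rewrite -(mulr_natl (d + eta)) natrM expr2.
  apply: ler_sum => i _; rewrite average_sum; last first.
    by move=> j; exact: bounded_continuous_cosc.
  rewrite (bigD1 i) //= [X in _ <= _ + X](bigD1 i) //= addrA; apply: lerD.
    under eq_fun do rewrite subrr cosc0.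
    by rewrite average_cst lerDl addr_ge0 // ltW.
  apply: ler_sum => j ji; rewrite eq_sym in ji.
  have call : forall p : 'I_N * 'I_N, p.1 != p.2 -> corr_le n p.1 p.2 by near: n.
  exact: (call (i, j)).
rewrite /phase_mean.
move: u_le v_le c_le s_le sq_le; set a := A n _; set b := A n _.
set C := \sum_(i < N) _; set S := \sum_(i < N) _.
have NV0 : 0 < N%:R^-1 :> R by rewrite invr_gt0 ltr0n.
move=> u_le v_le c_le s_le sq_le.
have sq_le' : (N%:R^-1 * C) ^+ 2 + (N%:R^-1 * S) ^+ 2 <= N%:R^-1 + (d + eta).
  rewrite !exprMn -mulrDr.
  apply: le_trans (ler_wpM2l (sqr_ge0 _) sq_le) _.
  by rewrite mulrDr mulrA -exprMn mulVf // expr1n mul1r expr2 -mulrA mulVf // mulr1.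
move: sq_le' u_le v_le; move: (N%:R^-1 * C) (N%:R^-1 * S) => u v.
rewrite !ler_norml => sq_le' /andP[u1 u2] /andP[v1 v2].
move: c_le s_le; rewrite !ler_norml => /andP[a1 a2] /andP[b1 b2].
apply: le_trans eta_e.
(* [q ^+ 2 - p ^+ 2] factors as [(q - p) * (q + p)], where the second factor is at most 3 in
   absolute value because [eta <= 1]. *)
have key (p q : R) : -1 <= q <= 1 -> - eta <= p - q <= eta ->
    q ^+ 2 <= p ^+ 2 + 3 * eta.
  move=> /andP[q1 q2] /andP[p1 p2].
  have : (q - p) * (q + p) <= 3 * eta.
    apply: le_trans (ler_norm _) _; rewrite normrM mulrC.
    apply: ler_pM; rewrite ?normr_ge0 // ler_norml; apply/andP; split; lra.
  have -> : q ^+ 2 = p ^+ 2 + (q - p) * (q + p) by ring.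
  by move=> h; rewrite lerD2l.
have ka := key u a; have kb := key v b.
have {}ka := ka (introT andP (conj a1 a2)) (introT andP (conj u1 u2)).
have {}kb := kb (introT andP (conj b1 b2)) (introT andP (conj v1 v2)).
lra.
Unshelve. all: by end_near. Qed.

End averaging.

(** The multiple [C] is fixed before [Q]. This uniformity lets the induction give one [n] valid for
    the differences of [Q] along all group elements. *)
Lemma poly_phase_dichotomy (R : realType) (G : topologicalGroupType)
    (A : nat -> (G -> R) -> R) d (e : R) : averaging A -> 0 < e ->
  exists2 C, (0 < C)%N & forall Q : G -> circle R, circle_continuous Q ->
    poly_lt d.+1 Q ->
    (\forall n \near \oo, phase_mean A n Q <= e) \/
    constant_map (fun x => Q x *+ C).
Proof.
move=> avA; elim: d e => [|d IH] e e0.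
  by exists 1%N => // Q _ pQ; right => x y; rewrite (poly_lt1_constant pQ x y).
have e4 : 0 < e / 4 by rewrite divr_gt0.
(* Van der Corput's inequality takes correlations bounded by a square, here that of [e / 4]. *)
have [n n0 {}IH] := IH _ (exprn_gt0 2 e4).
(* [N] exceeds [4 / e], so the diagonal contribution is below [e / 4]; [k] is a multiple of every
   exponent [0 < l < N]. *)
pose N := (Num.truncn (4 / e)).+1; pose k := N`!.
have N_e : N%:R^-1 + e / 4 < e.
  have : N%:R^-1 < e / 4.
    by rewrite -[e / 4]invrK ltf_pV2 ?posrE ?ltr0n ?invr_gt0 // invf_div truncnS_gt.
  lra.
exists (n * d.+1`! * k ^ d.+1)%N.
  by rewrite !muln_gt0 n0 fact_gt0 expn_gt0 fact_gt0.
move=> Q cQ pQ.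
have [small|big] := pselect (\forall n \near \oo, phase_mean A n Q <= e).
  by left.
right.
have cD g : exists2 l, (0 < l < N)%N &
    constant_map (fun x => Delta (g ^+ l)%g Q x *+ n).
  apply: contrapT => ncD; apply: big.
  apply: (@van_der_corput _ _ _ avA _ g N (e / 4)) => //; first exact: ltW.
  move=> l lN.
  have [//|cl] := IH _ (circle_continuous_Delta (g ^+ l)%g cQ) (pQ (g ^+ l)%g).
  by exfalso; apply: ncD; exists l.
have {}cD g : constant_map (fun x => Delta (g ^+ k)%g Q x *+ n).
  have [l /andP[l0 lN] cl] := cD g.
  have /dvdnP[q ->] : (l %| k)%N by rewrite dvdn_fact // l0 ltnW.
  move=> x y; rewrite mulnC expgnA !(expg_Delta_constant q cl).
  by rewrite (cl x y).
have D0 g x : Delta (g ^+ k)%g Q x *+ n *+ d.+1`! = 0.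
  apply: contrapT => /eqP t0; apply: big.
  have Qt y : Q ((g ^+ k) ^+ (n * d.+1`!) * y)%g =
      Q y + Delta (g ^+ k)%g Q x *+ n *+ d.+1`!.
    by rewrite (constant_Delta_affine n0 pQ (cD g)) (cD g y x).
  have /cvgr0_norm_le /(_ _ e0) := phase_mean_rotation avA cQ t0 Qt.
  by apply: filterS => i; apply: le_trans; exact: ler_norm.
move=> x y; rewrite !(mulrnA _ (n * d.+1`!)).
apply: (@power_invariant_constant _ _ d.+1 (fun x => Q x *+ (n * d.+1`!))).
  exact: poly_lt_mulrn.
move=> g z; apply/eqP; rewrite -subr_eq0 -mulrnBl mulrnA.
by rewrite -[Q _ - Q _]/(Delta (g ^+ k)%g Q z) D0.
Qed.

(** * Borel integrals *)

Section borel_integral.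
Context (R : realType) (X : ptopologicalType).
Implicit Types (f : X -> R) (m : {measure set (borel X) -> \bar R}).

Lemma continuous_borel_fun (Y : ptopologicalType) (f : X -> Y) : continuous f ->
  measurable_fun [set: borel X] (f : borel X -> borel Y).
Proof.
move=> /continuousP cf.
apply: (@measurability _ _ (borel X) (borel Y) setT f (@open Y)) => //.
move=> _ [B oB <-].
by rewrite setTI; apply: sub_sigma_algebra; exact: cf.
Qed.

Lemma continuous_measurable_borel f : continuous f ->
  measurable_fun [set: borel X] (f : borel X -> R).
Proof.
move=> /continuousP cf; apply: (measurability _ (RGenOInfty.measurableE R)).
move=> _ [_ [x ->] <-].
by rewrite setTI; apply: sub_sigma_algebra; apply: cf; exact: interval_open.
Qed.

Lemma bounded_continuous_integrable m (D : set (borel X)) f : measurable D ->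
  (m D < +oo)%E -> bounded_continuous f -> m.-integrable D (EFin \o f).
Proof.
move=> mD mDoo [cf [B fB]]; apply: measurable_bounded_integrable => //.
  by apply: measurable_funTS; exact: continuous_measurable_borel.
exists B; split=> [|M BM x Dx /=]; first exact: num_real.
by rewrite (le_trans (fB x)) // ltW.
Qed.

Lemma Rintegral_bound m (D : set (borel X)) f B : measurable D ->
  (m D < +oo)%E -> bounded_continuous f -> (forall x, `|f x| <= B) ->
  `|Rintegral m D f| <= B * fine (m D).
Proof.
move=> mD mDoo bf fB; rewrite -Rintegral_cst //.
have intf := bounded_continuous_integrable mD mDoo bf.
apply: le_trans (le_normr_Rintegral mD intf) _.
apply: le_Rintegral => //; first exact: integrable_norm.
by apply: bounded_continuous_integrable => //; exact: bounded_continuous_cst.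
Qed.

(** Change of variables: the pushforward of [m] under [tau] is [m] itself. *)
Lemma Rintegral_invariant m (tau : X -> X) (D : set (borel X)) f :
  continuous tau ->
  (forall A : set (borel X), measurable A -> m (tau @^-1` A) = m A) ->
  measurable D -> (m D < +oo)%E -> bounded_continuous f ->
  Rintegral m (tau @^-1` D) (fun x => f (tau x)) = Rintegral m D f.
Proof.
move=> ctau inv mD mDoo bf; congr fine.
have mtau := continuous_borel_fun ctau.
have mf := continuous_measurable_borel bf.1.
have /measurable_EFinP mfE := mf.
have mtD : measurable (tau @^-1` D : set (borel X)).
  by rewrite -[X in measurable X]setTI; exact: mtau.
have intf : m.-integrable (tau @^-1` D) (EFin \o (fun x => f (tau x))).
  apply: bounded_continuous_integrable; rewrite ?inv //.
  case: bf => cf [B fB]; split; last by exists B => x; exact: fB.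
  by move=> x; apply: (@continuous_comp _ _ _ tau f); [exact: ctau|exact: cf].
apply: etrans (esym (@integral_pushforward _ _ (borel X) (borel X) R tau mtau m
  D _ mfE intf mD)) _.
by apply: eq_measure_integral => A mA _; exact: inv.
Qed.

(** The integrals over the common part cancel, and the two set differences make up the symmetric
    difference. *)
Lemma Rintegral_setY_bound m (A D : set (borel X)) f B :
  measurable A -> measurable D -> (m A < +oo)%E -> (m D < +oo)%E ->
  bounded_continuous f -> (forall x, `|f x| <= B) ->
  `|Rintegral m A f - Rintegral m D f| <= B * fine (m (A `+` D)).
Proof.
move=> mA mD mAoo mDoo bf fB.
have int S : measurable S -> (m S < +oo)%E -> m.-integrable S (EFin \o f).
  by move=> mS Soo; exact: bounded_continuous_integrable.
have mAD := measurableD mA mD; have mDA := measurableD mD mA.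
have lt_oo (S S' : set (borel X)) : measurable S -> measurable S' -> S `<=` S' ->
    (m S' < +oo)%E -> (m S < +oo)%E.
  by move=> mS mS' sub; apply: le_lt_trans; apply: le_measure; rewrite ?inE.
have ADoo : (m (A `\` D) < +oo)%E by apply: lt_oo mAoo => // x [].
have DAoo : (m (D `\` A) < +oo)%E by apply: lt_oo mDoo => // x [].
have split_int (S S' : set (borel X)) : measurable S -> measurable S' ->
    (m S < +oo)%E ->
    Rintegral m S f = Rintegral m (S `&` S') f + Rintegral m (S `\` S') f.
  move=> mS mS' Soo; rewrite -Rintegral_setU.
  - by rewrite setUIDK.
  - exact: measurableI.
  - exact: measurableD.
  - by rewrite setUIDK; exact: int.
  - by apply/disj_setPS => x [[_ sx] [_ nx]]; exact: nx.
rewrite (split_int A D) // (split_int D A) // [D `&` A]setIC.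
rewrite opprD addrACA subrr add0r.
apply: le_trans (ler_normB _ _) _.
have -> : m (A `+` D) = (m (A `\` D) + m (D `\` A))%E.
  rewrite /setY measureU //; apply/seteqP; split=> // x [[Ax _] [_ nAx]]; exact: nAx.
rewrite fineD ?ge0_fin_numE // mulrDr.
by apply: lerD; exact: Rintegral_bound.
Qed.

End borel_integral.

(** * Averages along a Følner sequence *)

Section folner_average.
Context (R : realType) (G : topologicalGroupType).
Context (m : {measure set (borel G) -> \bar R}) (haar_m : left_haar m).

Lemma lmul_preimage (g : G) (A : set G) :
  [set (g * x)%g | x in A] = (fun x => (g^-1 * x)%g) @^-1` A.
Proof.
apply/seteqP; split=> [_ [x Ax <-]|x Ax] /=; first by rewrite mulKg.
by exists (g^-1 * x)%g => //; rewrite mulVKg.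
Qed.

Lemma measurable_lmul (g : G) (A : set (borel G)) : measurable A ->
  measurable ([set (g * x)%g | x in A] : set (borel G)).
Proof.
move=> mA; rewrite lmul_preimage -[X in measurable X]setTI.
by apply: continuous_borel_fun mA => //; exact: lmul_continuous.
Qed.

Lemma haar_preimage (g : G) (A : set (borel G)) : measurable A ->
  m ((fun x => (g * x)%g) @^-1` A) = m A.
Proof.
case: haar_m => inv _ _ _ _ mA.
by rewrite -[g]invgK -lmul_preimage inv.
Qed.

Definition folner_average (F : (set G)^nat) (n : nat) (f : G -> R) : R :=
  (fine (m (F n)))^-1 * Rintegral m (F n) f.

(** For asymptotic invariance, left invariance of [m] turns the translated integrand into an
    integral over the translate of [F n]; the error is at most a bound of [f] times the relative
    measure of the symmetric difference. *)
Lemma averaging_folner F : folner m F -> averaging (folner_average F).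
Proof.
move=> [mF F0 Fg].
have Foo n : (m (F n) < +oo)%E by case/andP: (F0 n).
have F0' n : 0 < fine (m (F n)) by rewrite fine_gt0.
have int n f : bounded_continuous f -> m.-integrable (F n) (EFin \o f).
  by move=> bf; exact: bounded_continuous_integrable.
have bZ a (f : G -> R) : bounded_continuous f ->
    bounded_continuous (fun x => a * f x).
  by move=> bf; apply: bounded_continuousM => //; exact: bounded_continuous_cst.
split.
- move=> n a f h bf bh; rewrite /folner_average.
  have ia := int n _ (bZ a f bf).
  rewrite RintegralD //; last exact: int.
  rewrite RintegralZl //; last exact: int.
  by rewrite mulrDr mulrCA.
- move=> n f h bf bh fh; rewrite ler_pM2l ?invr_gt0 //.
  by apply: le_Rintegral => //; exact: int.
- by move=> n; rewrite /folner_average Rintegral_cst // mul1r mulVf // gt_eqF.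
- move=> g f bf; have [_ [B fB]] := bf.
  pose d n := fine (m ([set (g * x)%g | x in F n] `+` F n)) / fine (m (F n)).
  apply: (@squeeze_cvgr _ _ _ _ (fun n => - (B * d n)) (fun n => B * d n)).
  + apply: nearW => n; rewrite -ler_norml /folner_average.
    have mgF := measurable_lmul g (mF n).
    have gFE : F n = (fun x => (g * x)%g) @^-1` [set (g * x)%g | x in F n].
      by rewrite lmul_preimage; apply/funext => x /=; rewrite mulKg.
    have gFm : m [set (g * x)%g | x in F n] = m (F n).
      by rewrite {2}gFE haar_preimage.
    have -> : Rintegral m (F n) (fun x => f (g * x)%g) =
        Rintegral m [set (g * x)%g | x in F n] f.
      rewrite {1}gFE (@Rintegral_invariant _ _ m (fun x => (g * x)%g)) //.
      * exact: lmul_continuous.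
      * exact: haar_preimage.
      * by rewrite gFm.
    rewrite -mulrBr normrM gtr0_norm ?invr_gt0 // mulrC mulrA ler_pM2r ?invr_gt0 //.
    by apply: Rintegral_setY_bound; rewrite ?gFm.
  + rewrite -oppr0; apply: cvgN; rewrite -[X in _ --> X](mulr0 B).
    by apply: cvgM; [exact: cvg_cst|exact: Fg].
  + rewrite -[X in _ --> X](mulr0 B).
    by apply: cvgM; [exact: cvg_cst|exact: Fg].
Qed.

Lemma bounded_continuous_Lfun f : bounded_continuous f ->
  (f : borel G -> R) \in Lfun m +oo%E.
Proof.
move=> [cf [B fB]]; rewrite inE; apply/andP; split; rewrite inE /=.
  exact: continuous_measurable_borel.
rewrite /finite_norm unlock /Lnorm; case: ifPn => // _.
apply: (@le_lt_trans _ _ B%:E); last exact: ltry.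
apply: ereal_inf_lbound => /=; apply: aeW => x /=.
by rewrite lee_fin.
Qed.

End folner_average.

(** * Weyl's criterion *)

Section weyl.
Context (R : realType).
Local Notation T := (circle R).
Implicit Types (u f : T -> R) (y t : T).

Lemma circle_bounded_continuous u : continuous u -> bounded_continuous u.
Proof.
move=> cu; split=> //.
have /compact_bounded[M [_ uM]] : compact (u @` [set: T]).
  by apply: continuous_compact; [exact: continuous_subspaceT|exact: circle_compact].
exists (M + 1) => x; apply: (uM (M + 1)); first by rewrite ltrDl.
by exists x.
Qed.

Lemma circle_add_continuous (a : T) : continuous (fun x => a + x).
Proof.
have [r ->] := circle_piP a; apply: continuous_circle.
have -> : (fun x => circle_pi r + x) \o @circle_pi R =
    @circle_pi R \o (fun s => r + s).
  by apply/funext => s /=; rewrite circle_piD.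
move=> s; apply: continuous_comp; last exact: continuous_circle_pi.
by apply: cvgD; [exact: cvg_cst|exact: cvg_id].
Qed.

Lemma circle_sub_continuous (a : T) : continuous (fun x => x - a).
Proof.
rewrite (_ : (fun x => _) = (fun x => - a + x)); first exact: circle_add_continuous.
by apply/funext => x; rewrite addrC.
Qed.

(** This is cos(pi x) squared. It equals 1 only at 0, so its normalized powers form an approximate
    identity of trigonometric polynomials. *)
Definition bump x : R := (1 + cosc x) / 2.

Lemma bump_ge0 x : 0 <= bump x.
Proof. by have := norm_cosc_le1 x; rewrite ler_norml /bump => /andP[? ?]; lra. Qed.

Lemma bump_le1 x : bump x <= 1.
Proof. by have := norm_cosc_le1 x; rewrite ler_norml /bump => /andP[? ?]; lra. Qed.

Lemma bump0 : bump 0 = 1. Proof. by rewrite /bump cosc0; lra. Qed.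

Lemma bump_eq1 x : bump x = 1 -> x = 0.
Proof. by rewrite /bump => b1; apply: cosc_eq1; lra. Qed.

(** The subtraction formula for [cosc] separates the variables and reduces the claim to continuity
    in each of them. *)
Lemma continuous_bump_sub : continuous (fun p : T * T => bump (p.2 - p.1)).
Proof.
rewrite (_ : (fun p : T * T => _) = (fun p : T * T =>
  (1 + (cosc p.2 * cosc p.1 + sinc p.2 * sinc p.1)) * 2^-1)); last first.
  by apply/funext => p; rewrite /bump coscB.
have fst_cont (v : T -> R) : continuous v -> continuous (fun p : T * T => v p.1).
  by move=> cv p; apply: (@continuous_comp _ _ _ fst v); [exact: cvg_fst|exact: cv].
have snd_cont (v : T -> R) : continuous v -> continuous (fun p : T * T => v p.2).
  by move=> cv p; apply: (@continuous_comp _ _ _ snd v); [exact: cvg_snd|exact: cv].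
apply: continuous_realM; last exact: cst_continuous.
apply: continuous_realD; first exact: cst_continuous.
apply: continuous_realD; apply: continuous_realM.
- exact/snd_cont/continuous_cosc.
- exact/fst_cont/continuous_cosc.
- exact/snd_cont/continuous_sinc.
- exact/fst_cont/continuous_sinc.
Qed.

(** Closeness of two points is measured by [bump] of their difference. The pairs on which [u] varies
    by at least [e] form a compact set; its image under this function is compact and misses 1, hence
    stays away from 1. *)
Lemma bump_uniform_continuity u (e : R) : continuous u -> 0 < e ->
  exists2 rho : R, 0 <= rho < 1 &
    forall x y, rho < bump (y - x) -> `|u x - u y| <= e.
Proof.
move=> cu e0; pose D := [set p : T * T | e <= `|u p.1 - u p.2| ].
have cD : closed D.
  have cn : continuous (fun p : T * T => `|u p.1 - u p.2|).
    move=> p; apply: cvg_norm; apply: cvgB.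
      by apply: (@continuous_comp _ _ _ fst u); [exact: cvg_fst|exact: cu].
    by apply: (@continuous_comp _ _ _ snd u); [exact: cvg_snd|exact: cu].
  have -> : D = (fun p : T * T => `|u p.1 - u p.2|) @^-1` [set r | e <= r] by [].
  by apply: closed_comp; [move=> p _; exact: cn|exact: closed_ge].
have kD : compact D.
  apply: (subclosed_compact cD (compact_setX (@circle_compact R) (@circle_compact R))).
  by move=> p _.
have kW : compact ((fun p : T * T => bump (p.2 - p.1)) @` D).
  apply: continuous_compact => //; apply: continuous_subspaceT.
  exact: continuous_bump_sub.
have := compact_closed (@Rhausdorff R) kW; rewrite -openC openE => oW.
have /oW : (~` [set bump (p.2 - p.1) | p in D]) 1.
  move=> [[x y] Dxy /= /bump_eq1 /eqP]; rewrite subr_eq0 => /eqP yx.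
  by move: Dxy; rewrite /D /= yx subrr normr0 leNgt e0.
move=> /nbhs_ballP[d /= d0 ball1].
exists (Num.max 0 (1 - d)).
  by rewrite le_max lexx gt_max ltr01 ltrBlDr ltrDl d0.
move=> x y; rewrite gt_max => /andP[_ lt_b].
rewrite leNgt; apply/negP => e_lt.
apply: (ball1 (bump (y - x))); last by exists (x, y) => //=; rewrite /D /= ltW.
by rewrite /ball /= ger0_norm ?subr_ge0 ?bump_le1 // ltrBlDr addrC -ltrBlDr.
Qed.

Context (mu : probability (borel T) R) (hmu : circle_haar mu).

Definition circle_integral u : R := Rintegral mu setT u.
Local Notation I := circle_integral.

Let mu_lty : (mu setT < +oo)%E.
Proof. by rewrite probability_setT ltry. Qed.

Let int u : continuous u -> mu.-integrable [set: borel T] (EFin \o u).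
Proof.
move=> cu; apply: bounded_continuous_integrable => //.
exact: circle_bounded_continuous.
Qed.

Lemma circle_integral_cst c : I (fun=> c) = c.
Proof.
transitivity (c * fine (mu setT)); last by rewrite probability_setT mulr1.
exact: Rintegral_cst.
Qed.

Lemma circle_integralD u f : continuous u -> continuous f ->
  I (fun x => u x + f x) = I u + I f.
Proof. by move=> cu cf; apply: RintegralD => //; exact: int. Qed.

Lemma circle_integralZ c u : continuous u -> I (fun x => c * u x) = c * I u.
Proof. by move=> cu; apply: RintegralZl => //; exact: int. Qed.

Lemma circle_integral_le u f : continuous u -> continuous f ->
  (forall x, u x <= f x) -> I u <= I f.
Proof. by move=> cu cf uf; apply: le_Rintegral => //; exact: int. Qed.

Lemma circle_integral_norm_le u f : continuous u -> continuous f ->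
  (forall x, `|u x| <= f x) -> `|I u| <= I f.
Proof.
move=> cu cf uf; rewrite ler_norml -mulN1r -circle_integralZ //.
apply/andP; split; apply: circle_integral_le => //.
- by apply: continuous_realM; [exact: cst_continuous|exact: cf].
- by move=> x; have := uf x; rewrite ler_norml mulN1r => /andP[].
- by move=> x; have := uf x; rewrite ler_norml => /andP[].
Qed.

Lemma circle_integral_shift a u : continuous u -> I (fun x => u (a + x)) = I u.
Proof.
move=> cu; rewrite /circle_integral -{1}(preimage_setT (fun x => a + x)).
apply: (@Rintegral_invariant _ _ mu (fun x => a + x)).
- exact: circle_add_continuous.
- move=> A mA; rewrite -[RHS](hmu (- a)) //; congr (mu _).
  apply/seteqP; split=> [x Ax|_ [x Ax <-]] /=; last by rewrite addNKr.
  by exists (a + x) => //; rewrite addKr.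
- exact: measurableT.
- exact: mu_lty.
- exact: circle_bounded_continuous.
Qed.

Let circle_continuous_id : circle_continuous (fun x : T => x).
Proof. by split; [exact: continuous_cosc|exact: continuous_sinc]. Qed.

Lemma continuous_cosc_mulrn k : continuous (fun x : T => cosc (x *+ k)).
Proof. exact: (circle_continuousMn k circle_continuous_id).1. Qed.

Lemma continuous_sinc_mulrn k : continuous (fun x : T => sinc (x *+ k)).
Proof. exact: (circle_continuousMn k circle_continuous_id).2. Qed.

(* Translating by a half period changes the sign of the integrand. *)
Lemma circle_integral_cosc k : (0 < k)%N -> I (fun x : T => cosc (x *+ k)) = 0.
Proof.
move=> k0; pose a := circle_pi (2^-1 / k%:R : R).
have ak : a *+ k = circle_pi 2^-1.
  by rewrite -circle_piMn -[(_ / _) *+ k]mulr_natr divfK // pnatr_eq0 -lt0n.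
have pi2 : pi *+ 2 * 2^-1 = pi :> R by rewrite -[pi *+ 2]mulr_natr mulfK.
have := circle_integral_shift a (@continuous_cosc_mulrn k).
under eq_fun do rewrite mulrnDl ak coscD cosc_pi sinc_pi pi2 cospi sinpi mul0r subr0.
by rewrite circle_integralZ; [lra|exact: continuous_cosc_mulrn].
Qed.

(** The span of the functions cos(2 pi k x), given inductively so that statements linear in the
    polynomial reduce to a single frequency. *)
Inductive cosine_polynomial : (T -> R) -> Prop :=
| cosine_monomial c k : cosine_polynomial (fun x => c * cosc (x *+ k))
| cosine_polynomialD f u : cosine_polynomial f -> cosine_polynomial u ->
    cosine_polynomial (fun x => f x + u x).

Lemma continuous_cosine_polynomial f : cosine_polynomial f -> continuous f.
Proof.
elim=> [c k|{}f u _ cf _ cu]; last exact: continuous_realD.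
by apply: continuous_realM; [exact: cst_continuous|exact: continuous_cosc_mulrn].
Qed.

Lemma cosine_polynomialZ a f :
  cosine_polynomial f -> cosine_polynomial (fun x => a * f x).
Proof.
elim=> [c k|{}f u _ pf _ pu].
  by under eq_fun do rewrite mulrA; exact: cosine_monomial.
by under eq_fun do rewrite mulrDr; exact: cosine_polynomialD.
Qed.

(** Product-to-sum formula; frequency 0 is separate, as it has no predecessor in [nat]. *)
Lemma cosine_polynomialM f :
  cosine_polynomial f -> cosine_polynomial (fun x => cosc x * f x).
Proof.
elim=> [c [|k]|{}f u _ pf _ pu].
- rewrite (_ : (fun x => _) = (fun x => c * cosc (x *+ 1))).
    exact: cosine_monomial.
  by apply/funext => x; rewrite mulr0n cosc0 mulr1 mulr1n mulrC.
- rewrite (_ : (fun x => _) =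
    (fun x => c / 2 * cosc (x *+ k.+2) + c / 2 * cosc (x *+ k))).
    by apply: cosine_polynomialD; exact: cosine_monomial.
  apply/funext => x.
  have -> : x *+ k = x *+ k.+1 - x by rewrite mulrSr addrK.
  have -> : x *+ k.+2 = x *+ k.+1 + x by rewrite mulrSr.
  by rewrite coscD coscB; field.
- by under eq_fun do rewrite mulrDr; exact: cosine_polynomialD.
Qed.

Lemma cosine_polynomial_bumpX N : cosine_polynomial (fun x => bump x ^+ N).
Proof.
elim: N => [|N IH].
  rewrite (_ : (fun x => _) = (fun x => 1 * cosc (x *+ 0))).
    exact: cosine_monomial.
  by apply/funext => x; rewrite expr0 mulr0n cosc0 mulr1.
rewrite (_ : (fun x => _) =
  (fun x => 2^-1 * (bump x ^+ N + cosc x * bump x ^+ N))).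
  apply: cosine_polynomialZ; apply: cosine_polynomialD => //.
  exact: cosine_polynomialM.
by apply/funext => x; rewrite exprS; move: (bump x ^+ N) => b; rewrite /bump; field.
Qed.

(** For the even kernels used below, this is the usual convolution of [u] and [f] at [t]. *)
Definition convolution u f t : R := I (fun y => u y * f (y - t)).

Let bumpX_shift N t : continuous (fun y => bump (y - t) ^+ N).
Proof.
move=> y; apply: (@continuous_comp _ _ _ (fun y => y - t) (fun x => bump x ^+ N)).
  exact: circle_sub_continuous.
exact: continuous_cosine_polynomial (cosine_polynomial_bumpX N) _.
Qed.

Lemma circle_integral_bumpX_shift N t :
  I (fun y => bump (y - t) ^+ N) = I (fun y => bump y ^+ N).
Proof.
under eq_fun do rewrite addrC.
apply: (circle_integral_shift (- t)).
exact: continuous_cosine_polynomial (cosine_polynomial_bumpX N).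
Qed.

(* Finitely many translates of [{bump > s}] cover the circle. *)
Lemma circle_integral_bumpX_ge (s : R) : 0 <= s < 1 ->
  exists2 r : R, 0 < r & forall N, s ^+ N <= r * I (fun y => bump y ^+ N).
Proof.
move=> /andP[s0 s1]; have := @circle_compact R; rewrite compact_cover.
move=> /(_ _ setT (fun a => [set y | s < bump (y - a)])) [].
- move=> a _; have -> : [set y | s < bump (y - a)] =
      (fun y => bump (y - a) ^+ 1) @^-1` [set r | s < r] by [].
  have /continuousP := @bumpX_shift 1%N a; apply; exact: open_gt.
- by move=> y _; exists y => //=; rewrite subrr bump0.
move=> D _ coverD; pose r := finmap.enum_fset D.
have {coverD} cover y : exists2 a, a \in r & s < bump (y - a).
  by have [a /= aD ya] := coverD y Logic.I; exists a.
(* The number of translates in the cover, plus 1 to make positivity immediate. *)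
exists (\sum_(a <- r) 1 + 1).
  by rewrite ltr_wpDl // sumr_ge0.
move=> N; have I0 : 0 <= I (fun y => bump y ^+ N).
  rewrite -(circle_integral_cst 0); apply: circle_integral_le.
  - exact: cst_continuous.
  - exact: continuous_cosine_polynomial (cosine_polynomial_bumpX N).
  - by move=> x; rewrite exprn_ge0 // bump_ge0.
apply: (@le_trans _ _ (\sum_(a <- r) I (fun y => bump (y - a) ^+ N))).
  have [cS ->] : continuous (fun y => \sum_(a <- r) bump (y - a) ^+ N) /\
      \sum_(a <- r) I (fun y => bump (y - a) ^+ N) =
      I (fun y => \sum_(a <- r) bump (y - a) ^+ N).
    elim: (r) => [|a l [cl IH]].
      rewrite big_nil (_ : (fun y => _) = (fun=> 0)).
        by rewrite circle_integral_cst; split=> //; exact: cst_continuous.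
      by apply/funext => y; rewrite big_nil.
    rewrite (_ : (fun y => _) =
      (fun y => bump (y - a) ^+ N + \sum_(b <- l) bump (y - b) ^+ N)).
      split; last by rewrite big_cons IH circle_integralD.
      by apply: continuous_realD; [exact: bumpX_shift|exact: cl].
    by apply/funext => y; rewrite big_cons.
  rewrite -(circle_integral_cst (s ^+ N)); apply: circle_integral_le => //.
    exact: cst_continuous.
  (* A single translate whose set contains [y] already contributes at least [s ^+ N]. *)
  move=> y; have [a ar ya] := cover y.
  rewrite (big_rem a) //=; apply: ler_wpDr.
    by apply: sumr_ge0 => b _; rewrite exprn_ge0 // bump_ge0.
  by rewrite lerXn2r ?nnegrE // ?bump_ge0 // ltW.
under eq_bigr do rewrite circle_integral_bumpX_shift.
rewrite mulrDl mulr_suml; under [X in _ <= X + _]eq_bigr do rewrite mul1r.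
by rewrite lerDl mul1r.
Qed.

(** The difference is the integral of u(t) - u(y) against the kernel. Where [bump (y - t)] exceeds
    [rho], uniform continuity applies; elsewhere the kernel is at most [rho ^+ N], negligible
    against its total mass, which is at least a fixed multiple of [s ^+ N] with [rho < s]. *)
Lemma bump_approximation u (e : R) : continuous u -> 0 < e -> exists N,
  0 < I (fun y => bump y ^+ N) /\
  forall t, `|I (fun y => bump y ^+ N) * u t -
      convolution u (fun x => bump x ^+ N) t| <= e * I (fun y => bump y ^+ N).
Proof.
move=> cu e0; have e2 : 0 < e / 2 by rewrite divr_gt0.
have [rho /andP[rho0 rho1] urho] := bump_uniform_continuity cu e2.
have [_ [B uB]] := circle_bounded_continuous cu.
have B0 : 0 <= B by apply: le_trans (uB 0).
pose s := (1 + rho) / 2.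
have s01 : 0 <= s < 1 by rewrite /s; lra.
have s0 : 0 < s by rewrite /s; lra.
have [r r0 rI] := circle_integral_bumpX_ge s01.
have rs0 : 0 <= rho / s by rewrite divr_ge0 // ltW.
have q1 : `|rho / s| < 1.
  rewrite ger0_norm //.
  by rewrite ltr_pdivrMr // mul1r /s; lra.
(* Chosen so that [(2 * B + 1) * (del * (r * c))] is [e / 2 * c]; the added 1 keeps the denominator
   nonzero when [B = 0]. *)
pose del := e / 2 / (r * (2 * B + 1)).
have del0 : 0 < del by rewrite divr_gt0 // mulr_gt0 // ltr_wpDl // mulr_ge0.
have /cvgr0_norm_le /(_ _ del0) [N _ /(_ N (leqnn N))] := cvg_expr q1.
rewrite ger0_norm ?exprn_ge0 // => le_del.
set c := I (fun y => bump y ^+ N).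
have c0 : 0 < c.
  rewrite -(pmulr_rgt0 _ r0); apply: lt_le_trans (rI N).
  by rewrite exprn_gt0.
have rhoN : 2 * B * rho ^+ N <= e / 2 * c.
  have : rho ^+ N <= del * s ^+ N.
    by rewrite -ler_pdivrMr ?exprn_gt0 // -exprVn -exprMn.
  move=> h; have h2 : rho ^+ N <= del * (r * c).
    by apply: le_trans h _; rewrite ler_pM2l.
  have h3 : 2 * B * rho ^+ N <= (2 * B + 1) * (del * (r * c)).
    by apply: ler_pM => //; [rewrite mulr_ge0|rewrite exprn_ge0|rewrite lerDl].
  apply: le_trans h3 _; rewrite le_eqVlt; apply/orP; left; apply/eqP.
  have B1 : 2 * B + 1 != 0 by rewrite gt_eqF // ltr_wpDl // mulr_ge0.
  have r1 : r != 0 by rewrite gt_eqF.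
  by rewrite /del; field; rewrite B1 r1.
exists N; split=> // t; rewrite -/c.
have cK := @bumpX_shift N t.
have cuK : continuous (fun y => u y * bump (y - t) ^+ N).
  by apply: continuous_realM; [exact: cu|exact: cK].
have -> : c * u t - convolution u (fun x => bump x ^+ N) t =
    I (fun y => u t * bump (y - t) ^+ N + -1 * (u y * bump (y - t) ^+ N)).
  rewrite circle_integralD ?circle_integralZ //.
  - by rewrite circle_integral_bumpX_shift mulN1r mulrC.
  - by apply: continuous_realM; [exact: cst_continuous|exact: cK].
  - by apply: continuous_realM; [exact: cst_continuous|exact: cuK].
have cK2 : continuous (fun y => e / 2 * bump (y - t) ^+ N).
  by apply: continuous_realM; [exact: cst_continuous|exact: cK].
have -> : e * c = e / 2 * c + e / 2 * c by field.
apply: (@le_trans _ _ (I (fun y => e / 2 * bump (y - t) ^+ N + 2 * B * rho ^+ N))).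
  apply: circle_integral_norm_le.
  - apply: continuous_realD; apply: continuous_realM => //; exact: cst_continuous.
  - by apply: continuous_realD; [exact: cK2|exact: cst_continuous].
  move=> y; have K0 : 0 <= bump (y - t) ^+ N by rewrite exprn_ge0 // bump_ge0.
  rewrite mulN1r -mulrBl normrM (ger0_norm K0).
  have [near_t|far_t] := ltP rho (bump (y - t)).
    apply: ler_wpDr; first by rewrite !mulr_ge0 // exprn_ge0.
    by apply: ler_wpM2r => //; exact: urho.
  apply: ler_wpDl; first by rewrite mulr_ge0 // ltW.
  apply: ler_pM => //; last by rewrite lerXn2r // ?nnegrE ?bump_ge0.
  by apply: le_trans (ler_normB _ _) _; rewrite mulr2n mulrDl mul1r lerD.
rewrite circle_integralD //; last exact: cst_continuous.
rewrite circle_integral_cst circle_integralZ // circle_integral_bumpX_shift.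
by rewrite lerD2l.
Qed.

(** * From vanishing phase means to equidistribution *)

Section equidistribution.
Context (G : topologicalGroupType) (A : nat -> (G -> R) -> R).
Context (avA : averaging A) (Q : G -> T) (cQ : continuous Q).
Context (Q0 : forall k, (0 < k)%N ->
  phase_mean A n (fun x => Q x *+ k) @[n --> \oo] --> 0).

Let cQk k := circle_continuousMn k (continuous_circle_continuous cQ).

Let sqr_cvg0 (a b : nat -> R) : (a n ^+ 2 + b n ^+ 2) @[n --> \oo] --> 0 ->
  a n @[n --> \oo] --> 0.
Proof.
move=> ab0; apply/cvgr0Pnorm_le => e e0.
have /cvgr0_norm_le /(_ _ (exprn_gt0 2 e0)) := ab0.
apply: filterS => n le_e.
rewrite -ler_sqr ?nnegrE ?(ltW e0) // real_normK ?num_real //.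
apply: le_trans _ (le_trans (ler_norm _) le_e).
by rewrite lerDl sqr_ge0.
Qed.

(** For a single frequency [k], the subtraction formula makes the convolution at [Q x] a fixed
    linear combination of [cosc (Q x *+ k)] and [sinc (Q x *+ k)]. *)
Lemma average_convolution_cvg u f : continuous u -> cosine_polynomial f ->
  bounded_continuous (fun x => convolution u f (Q x)) /\
  A n (fun x => convolution u f (Q x)) @[n --> \oo] --> I u * I f.
Proof.
move=> cu; elim=> [c k|{}f h pf [bf cvf] ph [bh cvh]]; last first.
  have cf := continuous_cosine_polynomial pf.
  have ch := continuous_cosine_polynomial ph.
  have cshift v t : continuous v -> continuous (fun y => u y * v (y - t)).
    move=> cv; apply: continuous_realM => // y.
    apply: (@continuous_comp _ _ _ (fun y => y - t) v); last exact: cv.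
    exact: circle_sub_continuous.
  have convD : (fun x => convolution u (fun x => f x + h x) (Q x)) =
      (fun x => convolution u f (Q x) + convolution u h (Q x)).
    apply/funext => x; rewrite /convolution -circle_integralD; try exact: cshift.
    by congr I; apply/funext => y; rewrite mulrDr.
  rewrite convD; split; first exact: bounded_continuousD.
  rewrite circle_integralD // mulrDr.
  rewrite (_ : (fun n => _) = (fun n => A n (fun x => convolution u f (Q x)) +
      A n (fun x => convolution u h (Q x)))); first exact: cvgD.
  by apply/funext => n; rewrite (averageD avA).
pose Uc := I (fun y => u y * cosc (y *+ k)).
pose Us := I (fun y => u y * sinc (y *+ k)).
have cuc : continuous (fun y => u y * cosc (y *+ k)).
  by apply: continuous_realM; [exact: cu|exact: continuous_cosc_mulrn].
have cus : continuous (fun y => u y * sinc (y *+ k)).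
  by apply: continuous_realM; [exact: cu|exact: continuous_sinc_mulrn].
have convE : (fun x => convolution u (fun x => c * cosc (x *+ k)) (Q x)) =
    (fun x => (c * Uc) * cosc (Q x *+ k) + (c * Us) * sinc (Q x *+ k)).
  apply/funext => x; rewrite /convolution.
  rewrite (_ : (fun y => _) = (fun y => (c * cosc (Q x *+ k)) * (u y * cosc (y *+ k)) +
      (c * sinc (Q x *+ k)) * (u y * sinc (y *+ k)))).
    rewrite circle_integralD ?circle_integralZ //.
    - by rewrite -/Uc -/Us; ring.
    - by apply: continuous_realM; [exact: cst_continuous|exact: cuc].
    - by apply: continuous_realM; [exact: cst_continuous|exact: cus].
  by apply/funext => y; rewrite mulrnBl coscB; ring.
have bc := bounded_continuous_cosc (cQk k).
have bs := bounded_continuous_sinc (cQk k).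
have bZ (a : R) (v : G -> R) : bounded_continuous v ->
    bounded_continuous (fun x => a * v x).
  by move=> bv; apply: bounded_continuousM => //; exact: bounded_continuous_cst.
rewrite convE; split; first by apply: bounded_continuousD; exact: bZ.
rewrite (_ : (fun n => _) = (fun n => (c * Uc) * A n (fun x => cosc (Q x *+ k)) +
    (c * Us) * A n (fun x => sinc (Q x *+ k)))); last first.
  by apply/funext => n; rewrite (averageD avA) ?(averageZ avA) //; exact: bZ.
rewrite circle_integralZ; last exact: continuous_cosc_mulrn.
(* At frequency 0 the averaged function is constant; at any other both averages tend to 0, and the
   integral of the monomial is 0 as well. *)
have [k0|k0] := posnP k.
  have Uc0 : Uc = I u.
    by congr I; apply/funext => y; rewrite k0 mulr0n cosc0 mulr1.
  have Us0 : Us = 0.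
    rewrite -(circle_integral_cst 0).
    by congr I; apply/funext => y; rewrite k0 mulr0n sinc0 mulr0.
  rewrite (_ : (fun n => _) = (fun=> c * I u)).
    rewrite (_ : I u * _ = c * I u); first exact: cvg_cst.
    rewrite (_ : (fun x => cosc (x *+ k)) = fun=> 1).
      by rewrite circle_integral_cst mulr1 mulrC.
    by apply/funext => y; rewrite k0 mulr0n cosc0.
  apply/funext => n; rewrite Uc0 Us0 mulr0 mul0r addr0.
  rewrite (_ : (fun x => _) = fun=> 1) ?(average_cst avA) ?mulr1 //.
  by apply/funext => y; rewrite k0 mulr0n cosc0.
rewrite circle_integral_cosc // !mulr0.
have Ac := sqr_cvg0 (Q0 k0).
have As : A n (fun x => sinc (Q x *+ k)) @[n --> \oo] --> 0.
  apply: (@sqr_cvg0 _ (fun n => A n (fun x => cosc (Q x *+ k)))).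
  by under eq_fun do rewrite addrC; exact: Q0.
have := cvgD (cvgM (cvg_cst (c * Uc)) Ac) (cvgM (cvg_cst (c * Us)) As).
by rewrite !mulr0 addr0; apply.
Qed.

(** With [c] the mass of a high power of [bump], the convolution is uniformly close to [c * u] and
    its averages tend to [I u * c]. All errors are proportional to [c], which is cancelled at the
    end. *)
Lemma weyl_criterion u : continuous u ->
  A n (fun x => u (Q x)) @[n --> \oo] --> I u.
Proof.
move=> cu; apply/cvgrPdist_le => e e0.
have e2 : 0 < e / 2 by rewrite divr_gt0.
have [N [c0 approx]] := bump_approximation cu e2.
have pN := cosine_polynomial_bumpX N.
have [bconv cvconv] := average_convolution_cvg cu pN.
set c := I _ in c0 approx cvconv.
have ce0 : 0 < c * (e / 2) by rewrite mulr_gt0.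
have bu : bounded_continuous (fun x => u (Q x)).
  have [_ [B uB]] := circle_bounded_continuous cu.
  split; last by exists B.
  by move=> x; apply: (@continuous_comp _ _ _ Q u); [exact: cQ|exact: cu].
have bcu : bounded_continuous (fun x => c * u (Q x)).
  by apply: bounded_continuousM => //; exact: bounded_continuous_cst.
have bcv : bounded_continuous (fun x => -1 * convolution u (fun x => bump x ^+ N) (Q x)).
  by apply: bounded_continuousM => //; exact: bounded_continuous_cst.
have /cvgrPdist_le /(_ _ ce0) := cvconv.
apply: filterS => n le_n.
have : `|c * A n (fun x => u (Q x)) -
    A n (fun x => convolution u (fun x => bump x ^+ N) (Q x))| <= e / 2 * c.
  rewrite -(averageZ avA) // -mulN1r -(averageZ avA) // -(averageD avA) //.
  apply: (average_bound avA) => [|x]; first exact: bounded_continuousD.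
  by rewrite mulN1r.
move: le_n; set a := A n _; set b := A n _ => le1 le2.
rewrite -(ler_pM2l c0) -{1}(gtr0_norm c0) -normrM.
have -> : c * (I u - b) = (I u * c - a) + (a - c * b) by ring.
apply: le_trans (ler_normD _ _) _; rewrite (distrC a (c * b)).
apply: le_trans (lerD le1 le2) _.
by rewrite le_eqVlt; apply/orP; left; apply/eqP; field.
Qed.

End equidistribution.

End weyl.

(** * The main theorem *)

(** Pigeonhole: two of the cosets of x^0, ..., x^n coincide, where n bounds the number of cosets, so
    some x^l with 0 < l <= n lies in [H]; n! is a multiple of every such l. *)
Lemma finite_index_power (G : topologicalGroupType) (H : groupClosed G) :
  finite_index H -> exists2 k, (0 < k)%N & forall x : G, (x ^+ k)%g \in H.
Proof.
move=> /finite_seqP[s sE]; exists (size s)`!; first exact: fact_gt0.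
move=> x; pose coset i := [set (x ^+ i * h)%g | h in [set` H]].
have coset_s i : coset i \in s.
  have : [set [set (g * h)%g | h in [set` H]] | g in [set: G]] (coset i).
    by exists (x ^+ i)%g.
  by rewrite sE.
have [l /andP[l0 ls] xl] : exists2 l, (0 < l <= size s)%N & (x ^+ l)%g \in H.
  have : ~~ uniq (mkseq coset (size s).+1).
    apply/negP => us; have sub : {subset mkseq coset (size s).+1 <= s}.
      by move=> y /mapP[i _ ->].
    by have := uniq_leq_size us sub; rewrite size_mkseq ltnn.
  move=> /(uniqPn set0)[i [j [ij]]]; rewrite size_mkseq => js.
  rewrite !nth_mkseq ?(ltn_trans ij js) // => cij.
  exists (j - i)%N; first by rewrite subn_gt0 ij (leq_trans (leq_subr _ _)).
  have : coset j (x ^+ j)%g by exists 1%g; rewrite /= ?gpred1 ?mulg1.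
  rewrite -cij => -[h /= hH]; rewrite -{1}(subnKC (ltnW ij)) expgnDr.
  by move=> /mulgI <-.
have /dvdnP[q ->] : (l %| (size s)`!)%N by rewrite dvdn_fact // l0.
by rewrite mulnC expgnA gpredXn.
Qed.

Definition torsion (V : zmodType) (k : nat) : {pred V} := [pred x | x *+ k == 0].

Lemma torsion_zmod_closed (V : zmodType) k : zmod_closed (@torsion V k).
Proof.
split=> [|x y]; rewrite !inE ?mul0rn // => /eqP x0 /eqP y0.
by rewrite mulrnBl x0 y0 subrr.
Qed.

HB.instance Definition _ (V : zmodType) k :=
  GRing.isZmodClosed.Build V (@torsion V k) (@torsion_zmod_closed V k).

(** The values of [P] differ from [P t0] by [k]-torsion elements, of which the circle has finitely
    many. *)
Lemma constant_mulrn_coset (R : realType) (T : Type) (t0 : T)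
    (P : T -> circle R) k : (0 < k)%N ->
  (forall x y, P x *+ k = P y *+ k) -> in_finite_subgroup_coset P.
Proof.
move=> k0 cP; exists [the zmodClosed (circle R) of @torsion (circle R) k].
  rewrite (_ : [set` _] = [set x | x *+ k = 0]); first exact: circle_torsion_finite.
  by apply/seteqP; split=> x /=; rewrite inE => /eqP.
by exists (P t0) => x; rewrite inE mulrnBl (cP x t0) subrr.
Qed.

(** * Coordinatewise convergence of complex numbers *)

Section complex_topology.
Context (R : realType).

Let normc_ge_Im (z : R[i]) : `|complex.Im z|%:C%C <= `|z|.
Proof. by rewrite normc_def lecR -sqrtr_sqr ler_wsqrtr // lerDr sqr_ge0. Qed.

Lemma continuous_Re : continuous (fun z : Cplx R => complex.Re z).
Proof.
move=> z; have Fz : Filter (nbhs (z : Cplx R)) by exact: nbhs_filter.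
apply/(@cvgrPdist_lt _ _ _ (nbhs (z : Cplx R)) Fz) => e e0.
have : \forall w \near (z : Cplx R), `|z - w| < e%:C%C.
  by apply: (@nbhsx_ballx _ (Cplx R) z e%:C%C); rewrite ltcR.
apply: (@filterS _ (nbhs (z : Cplx R)) Fz) => w zw.
by rewrite -ltcR; apply: le_lt_trans zw; rewrite -raddfB; exact: normc_ge_Re.
Qed.

Lemma continuous_Im : continuous (fun z : Cplx R => complex.Im z).
Proof.
move=> z; have Fz : Filter (nbhs (z : Cplx R)) by exact: nbhs_filter.
apply/(@cvgrPdist_lt _ _ _ (nbhs (z : Cplx R)) Fz) => e e0.
have : \forall w \near (z : Cplx R), `|z - w| < e%:C%C.
  by apply: (@nbhsx_ballx _ (Cplx R) z e%:C%C); rewrite ltcR.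
apply: (@filterS _ (nbhs (z : Cplx R)) Fz) => w zw.
by rewrite -ltcR; apply: le_lt_trans zw; rewrite -raddfB; exact: normc_ge_Im.
Qed.

Lemma cvg_complex (a b : nat -> R) (la lb : R) :
  a n @[n --> \oo] --> la -> b n @[n --> \oo] --> lb ->
  ((a n +i* b n)%C : Cplx R) @[n --> \oo] --> ((la +i* lb)%C : Cplx R).
Proof.
move=> ca cb; apply/(@cvgrPdist_lt R[i] (Cplx R)) => -[e e'].
(* The radius is a complex number; positivity forces its imaginary part to be 0. *)
rewrite ltcE /= => /andP[/eqP -> e0].
have e2 : 0 < e / 2 by rewrite divr_gt0.
have /cvgrPdist_lt /(_ _ e2) na := ca; have /cvgrPdist_lt /(_ _ e2) nb := cb.
near=> n.
have an : `|la - a n| < e / 2 by near: n.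
have bn : `|lb - b n| < e / 2 by near: n.
rewrite normc_def ltcR /=.
have sq (x : R) : `|x| < e / 2 -> x ^+ 2 < e ^+ 2 / 2.
  move=> xe; rewrite -real_normK ?num_real //.
  have : `|x| ^+ 2 < (e / 2) ^+ 2 by rewrite ltrXn2r // nnegrE ltW.
  by move=> h; apply: lt_trans h _; rewrite expr_div_n ltr_pM2l ?exprn_gt0 //; lra.
rewrite -[ltRHS](gtr0_norm e0) -sqrtr_sqr ltr_sqrt ?exprn_gt0 //.
by have := sq _ an; have := sq _ bn; lra.
Unshelve. all: by end_near. Qed.

End complex_topology.

Lemma poly_lt_subgroup (G : topologicalGroupType) (V : PreTopologicalZmodule.type)
    (H : groupClosed G) d (P : G -> V) : poly_lt d P ->
  poly_lt d (fun x : subgroup_type H => P (val x)).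
Proof.
elim: d P => [|d IH] P /= pP; first by move=> x; rewrite pP.
by move=> g; exact: IH (pP (val g)).
Qed.

(** The left translate of [P] by [g] is constant on [H], which contains all [k]-th powers for some
    [k], so [constant_on_subgroup] applies to it. *)
Lemma constant_on_coset (G : topologicalGroupType) (V : PreTopologicalZmodule.type)
    (H : groupClosed G) d (P : G -> V) (g : G) : finite_index H ->
  poly_lt d.+1 P -> constant_map (fun x : subgroup_type H => P (g * val x)%g) ->
  exists2 k, (0 < k)%N & constant_map (fun x => P x *+ k).
Proof.
move=> fH pP cP; have [k k0 Hk] := finite_index_power fH.
have [K K0 cK] := @constant_on_subgroup G V [set` H] k d Hk gpred1
  (fun x y xH yH => gpredM x y xH yH) k0.
exists K => // x y.
have := cK (fun x => P (g * x)%g) (poly_lt_lshift g pP).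
move=> /(_ _)/(_ (g^-1 * x)%g (g^-1 * y)%g); rewrite !mulVKg; apply => h hH.
exact: cP (exist _ h hH) 1%g.
Qed.

(** The dichotomy is applied to each multiple of [Q] at every precision [e]; its second alternative
    would make a further multiple constant. *)
Lemma phase_mean_cvg0 (R : realType) (G : topologicalGroupType)
    (A : nat -> (G -> R) -> R) d (Q : G -> circle R) : averaging A ->
  continuous Q -> poly_lt d.+1 Q ->
  (forall k, (0 < k)%N -> ~ constant_map (fun x => Q x *+ k)) ->
  forall k, (0 < k)%N -> phase_mean A n (fun x => Q x *+ k) @[n --> \oo] --> 0.
Proof.
move=> avA cQ pQ ncQ k k0; apply/cvgr0Pnorm_le => e e0.
have [C C0 dich] := poly_phase_dichotomy d avA e0.
have [] := dich (fun x => Q x *+ k).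
- exact/circle_continuousMn/continuous_circle_continuous.
- exact: poly_lt_mulrn.
- apply: filterS => n; rewrite ger0_norm //.
  by rewrite /phase_mean addr_ge0 // sqr_ge0.
- move=> cQk; exfalso; apply: (ncQ (k * C)%N); first by rewrite muln_gt0 k0.
  by move=> x y; rewrite !mulrnA; exact: cQk.
Qed.

Theorem theorem1p1 (R : realType) (G : topologicalGroupType)
    (hlc : locally_compact [set: G]) (hmet : metrizable R G)
    (ham : amenable R G) (P : G -> circle R) (hP : polynomial_map P)
    (mu : probability (borel (circle R)) R) (hmu : circle_haar mu) :
  totally_well_distributed P mu \/ in_finite_subgroup_coset P.
Proof.
have [d Pd] := hP; have cP := Pd.1; have pP := polynomial_of_degree_le_poly_lt Pd.
(* A constant positive multiple of [P] gives the finite coset; without one, equidistribution is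
   proved. *)
have [[k k0 cPk]|ncP] := pselect (exists2 k, (0 < k)%N &
    constant_map (fun x => P x *+ k)).
  by right; apply: (constant_mulrn_coset 1%g k0).
left=> H _ fH g.
pose Q := fun x : subgroup_type H => P (g^-1 * val x)%g.
have cQ : continuous Q.
  move=> x; apply: (@continuous_comp _ _ _
    (val : subgroup_type H -> G) (fun y => P (g^-1 * y)%g)).
    exact: subgroup_val_continuous.
  apply: (@continuous_comp _ _ _ (fun y => (g^-1 * y)%g) P).
    exact: lmul_continuous.
  exact: cP.
have pQ : poly_lt d.+1 Q.
  exact: (poly_lt_subgroup H (poly_lt_lshift g^-1%g pP)).
(* [Q] is [P] read on a coset of [H], so a constant multiple of [Q] would yield a constant multiple
   of [P] on the whole group. *)
have ncQ k : (0 < k)%N -> ~ constant_map (fun x => Q x *+ k).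
  move=> k0 cQk; apply: ncP.
  have [K K0 cK] := constant_on_coset fH (poly_lt_mulrn k pP) cQk.
  exists (k * K)%N; first by rewrite muln_gt0 k0.
  by move=> x y; rewrite !mulrnA; exact: cK.
split; first exact: continuous_borel_fun.
move=> f cf m haar_m.
have cRe : continuous (fun y => complex.Re (f y)).
  by move=> y; apply: (@continuous_comp _ _ _ f); [exact: cf|exact: continuous_Re].
have cIm : continuous (fun y => complex.Im (f y)).
  by move=> y; apply: (@continuous_comp _ _ _ f); [exact: cf|exact: continuous_Im].
have bQ (u : circle R -> R) : continuous u -> bounded_continuous (fun x => u (Q x)).
  move=> cu; have [_ [B uB]] := circle_bounded_continuous cu.
  split; last by exists B.
  by move=> x; apply: (@continuous_comp _ _ _ Q u); [exact: cQ|exact: cu].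
split.
  by split; apply: bounded_continuous_Lfun; [exact: bQ cRe|exact: bQ cIm].
move=> F folnerF; have avA := averaging_folner haar_m folnerF.
have Q0 := phase_mean_cvg0 avA cQ pQ ncQ.
have cvRe := weyl_criterion hmu avA cQ Q0 cRe.
have cvIm := weyl_criterion hmu avA cQ Q0 cIm.
rewrite (_ : (fun n => _) = (fun n =>
  (folner_average m F n (fun x => complex.Re (f (Q x))) +i*
   folner_average m F n (fun x => complex.Im (f (Q x))))%C)).
  exact: cvg_complex.
by apply/funext => n; rewrite /cintegral /folner_average; simpc.
Qed.
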